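(* Let $K\in\mathcal{U}C_{b}^{3}(\mathbb{R}^{d},\mathbb{R}^{d\times d})$, let $N\in\mathbb{N}$ and let $\{\alpha_{j}^{N}\}_{j=1,\dots,N}$ be real weights. Consider the system of interacting curves \[ \frac{\partial}{\partial t}\gamma_{t}^{i,N}(\sigma)=\sum_{j=1}^{N}\alpha_{j}^{N}\int_{0}^{1}K\left(\gamma_{t}^{i,N}(\sigma)-\gamma_{t}^{j,N}(\sigma')\right)\frac{\partial}{\partial\sigma'}\gamma_{t}^{j,N}(\sigma')\,d\sigma',\qquad i=1,\dots,N, \tag{E1} \] with $\gamma_{0}^{i,N}$ given, and to a family of curves associate the current $\xi_{t}:C_{b}(\mathbb{R}^{d};\mathbb{R}^{d})\to\mathbb{R}$, \[ \xi_{t}(\theta):=\sum_{j=1}^{N}\alpha_{j}^{N}\int_{0}^{1}\left\langle\theta\left(\gamma_{t}^{j,N}(\sigma)\right),\frac{\partial}{\partial\sigma}\gamma_{t}^{j,N}(\sigma)\right\rangle d\sigma. \tag{E2} \] Consider also the flow equation for currents \[ \xi_{t}=\varphi_{\sharp}^{t,K\ast\xi}\xi_{0},\qquad t\in[0,T]. \tag{E3} \] If $\{\gamma_{t}^{i,N}(\sigma),\ i=1,\dots,N,\ t\in[0,T],\ \sigma\in[0,1]\}$ is a family of $C^{1}([0,T]\times[0,1];\mathbb{R}^{d})$ functions satisfying (E1), then the current $\xi_{t}$, $t\in[0,T]$, defined by (E2) satisfies (E3). Conversely, if $\xi\in C([0,T];\mathcal{M}_{w})$ is the unique current-valued solution of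 (E3) with $\xi_{0}$ defined by (E2) at $t=0$ from a given family of $C^{1}$ initial curves $\{\gamma_{0}^{i,N}(\sigma),\ i=1,\dots,N,\ \sigma\in[0,1]\}$, then the representation (E2) holds with \[ \gamma_{t}^{i,N}(\sigma)=\varphi^{t,K\ast\xi}\left(\gamma_{0}^{i,N}(\sigma)\right), \] and these curves $\gamma_{t}^{i,N}$ satisfy (E1).
   Context: $\mathcal{U}C_{b}^{3}(\mathbb{R}^{d},\mathbb{R}^{d\times d})$ denotes the $C^{3}$ functions bounded with all derivatives up to order 3 such that $K$, $DK$, $D^{2}K$ are uniformly continuous. $\mathcal{M}=C_{b}(\mathbb{R}^{d};\mathbb{R}^{d})'$ is the space of 1-currents; $\mathcal{M}_{w}$ is $\mathcal{M}$ endowed with the metric $d(\xi,\xi')=\sup\{(\xi-\xi')(\theta):\|\theta\|_{\infty}+\mathrm{Lip}(\theta)\le1\}$. For $\xi\in\mathcal{M}$, $K\ast\xi$ is the vector field with components $(K\ast\xi)_{i}(x)=\xi(K_{i\cdot}(x-\cdot))$, where $K_{i\cdot}(z)=(K_{ij}(z))_{j=1,\dots,d}$. For a time-dependent current $\xi$, $\varphi^{t,K\ast\xi}$ is the flow of diffeomorphisms generated by the ODE $\frac{dx_{t}}{dt}=(K\ast\xi_{t})(x_{t})$. For a $C^{1}$ map $\varphi$, the push-forward of a current is $(\varphi_{\sharp}\xi)(\theta)=\xi(\varphi_{\sharp}\theta)$ with $(\varphi_{\sharp}\theta)(x)=D\varphi(x)^{T}\theta(\varphi(x))$. *)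

(* Defs.v *)
From HB Require Import structures.
From mathcomp Require Import all_boot all_order all_algebra.
From mathcomp Require Import all_classical all_reals all_analysis.
Set Implicit Arguments. Unset Strict Implicit. Unset Printing Implicit Defensive.
Import Order.TTheory GRing.Theory Num.Theory.
Import numFieldNormedType.Exports.
Local Open Scope classical_set_scope.
Local Open Scope ring_scope.

Section Defs.
Variables (R : realType) (d : nat).

Definition edot (u v : 'cV[R]_d) : R := \sum_(k < d) u k ord0 * v k ord0.
Definition enorm (u : 'cV[R]_d) : R := Num.sqrt (edot u u).
Definition ebasis (j : 'I_d) : 'cV[R]_d := delta_mx j ord0.

Definition current := ('cV[R]_d -> 'cV[R]_d) -> R.

Definition Cb (theta : 'cV[R]_d -> 'cV[R]_d) : Prop :=
  continuous theta /\ exists M : R, forall x, enorm (theta x) <= M.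

Definition is_current (xi : current) : Prop :=
  (forall theta1 theta2 (a : R), Cb theta1 -> Cb theta2 ->
     xi (fun x => theta1 x + a *: theta2 x) = xi theta1 + a * xi theta2) /\
  exists C : R, forall theta (M : R), Cb theta -> (forall x, enorm (theta x) <= M) ->
     `|xi theta| <= C * M.

Definition eqM (xi xi' : current) : Prop := forall theta, Cb theta -> xi theta = xi' theta.

(* test functions with ||theta||_oo + Lip(theta) <= 1 *)
Definition BL1 (theta : 'cV[R]_d -> 'cV[R]_d) : Prop :=
  Cb theta /\ exists a b : R, [/\ 0 <= a, 0 <= b, a + b <= 1,
    (forall x, enorm (theta x) <= a) &
    (forall x y, enorm (theta x - theta y) <= b * enorm (x - y))].

Definition dM (xi xi' : current) : R := sup [set xi theta - xi' theta | theta in BL1].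

Definition Mw_continuous (T : R) (xi : R -> current) : Prop :=
  (forall t, 0 <= t <= T -> is_current (xi t)) /\
  (forall t, 0 <= t <= T -> forall e : R, 0 < e ->
     exists2 delta : R, 0 < delta &
       forall s, 0 <= s <= T -> `|s - t| < delta -> dM (xi s) (xi t) < e).

Definition Kconv (K : 'cV[R]_d -> 'M[R]_d) (xi : current) (x : 'cV[R]_d) : 'cV[R]_d :=
  \col_i xi (fun y => \col_j K (x - y) i j).

(* push-forward: (phi_# xi)(theta) = xi (Dphi^T theta(phi)) ;
   (Dphi(x)^T v)_j = < v , d_j phi (x) > *)
Definition push (phi : 'cV[R]_d -> 'cV[R]_d) (xi : current) : current :=
  fun theta => xi (fun x => \col_j edot (theta (phi x)) ('D_(ebasis j) phi x)).

Definition dquot {V : normedModType R} (a b : R) (f : R -> V) (t : R) :=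
  (fun h : R => h^-1 *: (f (h + t) - f t)) @ within (fun h : R => a <= h + t <= b) (0 : R)^'.
Definition derivable_on {V : normedModType R} (a b : R) (f : R -> V) (t : R) : Prop :=
  cvg (dquot a b f t).
Definition deriv_on {V : normedModType R} (a b : R) (f : R -> V) (t : R) : V :=
  lim (dquot a b f t).
Definition has_deriv_on {V : normedModType R} (a b : R) (f : R -> V) (t : R) (l : V) : Prop :=
  dquot a b f t --> l.

Definition rect (T : R) : set (R * R) := [set p | 0 <= p.1 <= T /\ 0 <= p.2 <= 1].

Definition C1_rect (T : R) (g : R -> R -> 'cV[R]_d) : Prop :=
  [/\ (forall t s, 0 <= t <= T -> 0 <= s <= 1 ->
         derivable_on 0 T (fun t' => g t' s) t /\ derivable_on 0 1 (g t) s),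
      {within rect T, continuous (fun p : R * R => g p.1 p.2)},
      {within rect T, continuous (fun p : R * R => deriv_on 0 T (fun t' => g t' p.2) p.1)} &
      {within rect T, continuous (fun p : R * R => deriv_on 0 1 (g p.1) p.2)}].

Definition C1_01 (g : R -> 'cV[R]_d) : Prop :=
  [/\ (forall s, 0 <= s <= 1 -> derivable_on 0 1 g s),
      {within [set s : R | 0 <= s <= 1], continuous g} &
      {within [set s : R | 0 <= s <= 1], continuous (deriv_on 0 1 g)}].

(* integral over [0,1] (Lebesgue = Riemann for the continuous integrands at hand) *)
Definition int01 (f : R -> R) : R := \int[@lebesgue_measure R]_(s in `[0%R, 1%R]) f s.
Definition vint01 (f : R -> 'cV[R]_d) : 'cV[R]_d := \col_k int01 (fun s => f s k ord0).

Definition curves_current (N : nat) (alpha : 'I_N -> R)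
    (gamma : 'I_N -> R -> R -> 'cV[R]_d) (t : R) : current :=
  fun theta => \sum_(j < N) alpha j *
     int01 (fun s => edot (theta (gamma j t s)) (deriv_on 0 1 (gamma j t) s)).

Definition solves_E1 (T : R) (N : nat) (alpha : 'I_N -> R) (K : 'cV[R]_d -> 'M[R]_d)
    (gamma : 'I_N -> R -> R -> 'cV[R]_d) : Prop :=
  forall i t s, 0 <= t <= T -> 0 <= s <= 1 ->
    [/\ derivable_on 0 T (fun t' => gamma i t' s) t,
        derivable_on 0 1 (gamma i t) s &
        deriv_on 0 T (fun t' => gamma i t' s) t =
        \sum_(j < N) alpha j *:
           vint01 (fun s' => K (gamma i t s - gamma j t s') *m deriv_on 0 1 (gamma j t) s')].

Definition is_flow (T : R) (b : R -> 'cV[R]_d -> 'cV[R]_d) (phi : R -> 'cV[R]_d -> 'cV[R]_d) : Prop :=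
  forall x, phi 0 x = x /\
    forall t, 0 <= t <= T -> has_deriv_on 0 T (fun s => phi s x) t (b t (phi t x)).

Definition flow_eq (T : R) (K : 'cV[R]_d -> 'M[R]_d) (xi : R -> current) : Prop :=
  forall phi, is_flow T (fun t => Kconv K (xi t)) phi ->
    forall t, 0 <= t <= T -> eqM (xi t) (push (phi t) (xi 0)).

Definition pd (F : 'cV[R]_d -> 'M[R]_d) (a : 'I_d) : 'cV[R]_d -> 'M[R]_d :=
  fun x => 'D_(ebasis a) F x.
Definition unif_cont (F : 'cV[R]_d -> 'M[R]_d) : Prop :=
  forall e : R, 0 < e -> exists2 delta : R, 0 < delta &
    forall x y, `|x - y| < delta -> `|F x - F y| < e.
Definition UCb3 (K : 'cV[R]_d -> 'M[R]_d) : Prop :=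
  [/\ [/\ (forall a x, derivable K x (ebasis a)),
      (forall a b x, derivable (pd K a) x (ebasis b)) &
      (forall a b c x, derivable (pd (pd K a) b) x (ebasis c))],
      [/\ continuous K, (forall a, continuous (pd K a)),
          (forall a b, continuous (pd (pd K a) b)) &
          (forall a b c, continuous (pd (pd (pd K a) b) c))],
      (exists M : R, forall x, [/\ `|K x| <= M, (forall a, `|pd K a x| <= M),
          (forall a b, `|pd (pd K a) b x| <= M) &
          (forall a b c, `|pd (pd (pd K a) b) c x| <= M)]) &
      [/\ unif_cont K, (forall a, unif_cont (pd K a)) & (forall a b, unif_cont (pd (pd K a) b))]].

End Defs.

(* Main.v *)
(** The field b_t = K * xi_t is Lipschitz with a quadratic Taylor remainder,
    uniformly in t, as soon as xi_t is uniformly bounded in the dual of bounded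
    Lipschitz fields: for weakly continuous currents only that norm is controlled,
    and estimating the Taylor remainder of K in it costs the third derivative.
    By Gronwall, an affine relation between initial points is preserved by the flow
    of b up to second order. Hence its difference quotients are Cauchy, its
    derivative exists without solving the linearised equation, and the chain rule
    holds along C^1 curves: the push-forward of the current of a family of curves
    is the current of the transported curves. Finally (E1) says that each
    t |-> gamma_t(s) is a trajectory of b, which uniqueness of the ODE identifies
    with the flow line through gamma_0(s). *)

Require Import Defs.
From HB Require Import structures.
From mathcomp Require Import all_boot all_order all_algebra.
From mathcomp Require Import all_classical all_reals all_analysis.
From mathcomp Require Import ring lra.
Import Order.TTheory GRing.Theory Num.Theory.
Import numFieldNormedType.Exports.
Local Open Scope classical_set_scope.
Local Open Scope ring_scope.
Set Implicit Arguments. Unset Strict Implicit. Unset Printing Implicit Defensive.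

(** * Entrywise description of the max norm of matrices *)

Section MatrixNorm.
Variables (R : realType) (m n : nat).
Implicit Type A : 'M[R]_(m, n).

Lemma mx_norm_ge_entry A i j : `|A i j| <= `|A|.
Proof.
rewrite [leRHS]/Num.norm /= mx_normrE.
by apply/bigmax_geP; right; exists (i, j).
Qed.

Lemma mx_norm_le A c : 0 <= c -> (forall i j, `|A i j| <= c) -> `|A| <= c.
Proof.
move=> c0 Ac; rewrite [leLHS]/Num.norm /= mx_normrE.
by apply/bigmax_leP; split => // -[i j] _; exact: Ac.
Qed.

End MatrixNorm.

Lemma cvg_is_derive (R : realType) (V W : normedModType R) (f : V -> W)
    (x v : V) (l : W) :
  (h^-1 *: (f (h *: v + x) - f x) @[h --> (0 : R)^'] --> l) -> is_derive x v f l.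
Proof. by move=> H; apply: DeriveDef; [exact: cvgP H | exact: cvg_lim H]. Qed.

(** * Derivatives relative to a closed interval *)

Section OneSidedDerivative.
Variables (R : realType) (V : normedModType R).
Implicit Types (a b t : R) (f g : R -> V) (l : V).

(** Since the interval is nondegenerate, there are arbitrarily small admissible increments: positive
    ones if [t < b], negative ones if [t = b]. Properness is what makes the limit in [deriv_on]
    unique. *)
Lemma dquot_proper a b t : a < b -> a <= t <= b ->
  ProperFilter (within (fun h : R => a <= h + t <= b) (0 : R)^').
Proof.
move=> ab /andP[at_ tb]; apply: Build_ProperFilter_ex => P.
rewrite /within /= => /nbhs_ballP[e /= e0 He].
have [tlb|tb'] := ltP t b.
  pose h := Num.min (e / 2) (b - t).
  have h0 : 0 < h by rewrite lt_min divr_gt0//= subr_gt0.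
  exists h; apply: He => /=; last 2 first.
  - by rewrite gt_eqF.
  - have : h <= b - t by rewrite ge_min lexx orbT.
    by move: h0 at_; lra.
  rewrite /ball /= sub0r normrN gtr0_norm//.
  have : h <= e / 2 by rewrite ge_min lexx.
  by move: e0; lra.
have tE : t = b by apply/le_anti; rewrite tb tb'.
pose h := Num.min (e / 2) (b - a).
have h0 : 0 < h by rewrite lt_min divr_gt0//= subr_gt0.
exists (- h); apply: He => /=; last 2 first.
- by rewrite oppr_eq0 gt_eqF.
- have : h <= b - a by rewrite ge_min lexx orbT.
  by move: h0 at_; rewrite tE; lra.
rewrite /ball /= sub0r opprK gtr0_norm//.
have : h <= e / 2 by rewrite ge_min lexx.
by move: e0; lra.
Qed.

Lemma has_deriv_onP a b f t l : has_deriv_on a b f t l <->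
  forall e, 0 < e -> exists2 r : R, 0 < r & forall s, a <= s <= b ->
    `|s - t| < r -> `|f s - f t - (s - t) *: l| <= e * `|s - t|.
Proof.
rewrite /has_deriv_on /dquot; split => [/cvgrPdist_le H e e0|H].
  have /nbhs_ballP[r /= r0 Hr] := H _ e0.
  exists r => // s sab st.
  have [->|sNt] := eqVneq s t.
    by rewrite !subrr scale0r subrr !normr0 mulr0.
  have h0 : s - t != 0 by rewrite subr_eq0.
  have := Hr (s - t); rewrite /ball /= sub0r normrN subrK => /(_ st h0 sab).
  move=> {}Hr; rewrite (_ : f s - f t - _ =
      (s - t) *: ((s - t)^-1 *: (f s - f t) - l)); last first.
    by rewrite scalerBr scalerA mulfV// scale1r.
  by rewrite normrZ mulrC ler_wpM2r// distrC.
apply/cvgrPdist_le => e e0; have [r r0 Hr] := H _ e0.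
apply/nbhs_ballP; exists r => //= h; rewrite /ball /= sub0r normrN => hr h0 hab.
have := Hr (h + t) hab; rewrite addrK => /(_ hr) {}Hr.
rewrite distrC -(ler_pM2r (_ : 0 < `|h|)) ?normr_gt0// mulrC -normrZ.
by rewrite scalerBr scalerA mulfV// scale1r.
Qed.

Lemma has_deriv_on_derivable a b f t l :
  has_deriv_on a b f t l -> derivable_on a b f t.
Proof. exact: cvgP. Qed.

Lemma has_deriv_on_unique a b f t l : a < b -> a <= t <= b ->
  has_deriv_on a b f t l -> deriv_on a b f t = l.
Proof.
move=> ab tab H; have := dquot_proper ab tab => ?.
by apply: cvg_lim H; exact: norm_hausdorff.
Qed.

Lemma has_deriv_on_continuous a b f t l : has_deriv_on a b f t l ->
  forall e, 0 < e -> exists2 r : R, 0 < r & forall s, a <= s <= b ->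
    `|s - t| < r -> `|f s - f t| <= e.
Proof.
move=> /has_deriv_onP H e e0; have [r r0 Hr] := H _ ltr01.
exists (Num.min r (e / (1 + `|l|))).
  by rewrite lt_min r0 divr_gt0// ltr_pwDl.
move=> s sab; rewrite lt_min => /andP[sr].
rewrite ltr_pdivlMr ?ltr_pwDl// => sl.
rewrite -[f s - f t](subrK ((s - t) *: l)) (le_trans (ler_normD _ _))//.
rewrite (le_trans _ (ltW sl))// mulrDr mulr1 lerD//; last by rewrite normrZ.
by have := Hr _ sab sr; rewrite mul1r.
Qed.

(** At interior points small increments stay in the interval, so the derivative is two-sided and
    monotonicity criteria apply. *)
Lemma has_deriv_on_is_derive a b f t l : a < t < b ->
  has_deriv_on a b f t l -> is_derive t (1 : R) f l.
Proof.
move=> /andP[at_ tb] /has_deriv_onP H.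
apply: cvg_is_derive.
apply/cvgrPdist_le => e e0; have [r r0 Hr] := H _ e0.
apply/nbhs_ballP; exists (Num.min r (Num.min (t - a) (b - t))) => /=.
  by rewrite !lt_min r0 !subr_gt0 at_.
move=> h; rewrite /ball /= sub0r normrN !lt_min => /and3P[hr ha hb] h0.
have hab : a <= h + t <= b.
  by move: ha hb; rewrite !ltr_norml; lra.
have := Hr (h + t) hab; rewrite addrK => /(_ hr) {}Hr.
rewrite distrC -(ler_pM2r (_ : 0 < `|h|)) ?normr_gt0// mulrC -normrZ.
by rewrite scalerBr scalerA mulfV// scale1r scaler1.
Qed.

Lemma has_deriv_onDZ a b (c : R) f g t l l' : has_deriv_on a b f t l ->
  has_deriv_on a b g t l' ->
  has_deriv_on a b (fun s => f s + c *: g s) t (l + c *: l').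
Proof.
move=> /has_deriv_onP H /has_deriv_onP H'; apply/has_deriv_onP => e e0.
have [|r r0 Hr] := H (e / 2); first by rewrite divr_gt0.
have c0 : 0 < 2 * (1 + `|c|) by rewrite mulr_gt0// ltr_pwDl.
have [|r' r'0 Hr'] := H' (e / (2 * (1 + `|c|))); first by rewrite divr_gt0.
exists (Num.min r r'); first by rewrite lt_min r0.
move=> s sab; rewrite lt_min => /andP[sr sr'].
rewrite (_ : _ - _ = (f s - f t - (s - t) *: l) +
    c *: (g s - g t - (s - t) *: l')); last first.
  rewrite scalerDr scalerA [_ * c]mulrC -scalerA !opprD !scalerDr !scalerN.
  by rewrite [f s + _ + _]addrACA [LHS]addrACA.
rewrite (le_trans (ler_normD _ _))// [e in leRHS]splitr mulrDl lerD ?Hr//.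
rewrite normrZ (le_trans (ler_wpM2l _ (Hr' _ sab sr')))// mulrA ler_wpM2r//.
rewrite mulrA ler_pdivrMr// mulrC.
have := normr_ge0 c; move: e0; nra.
Qed.

Lemma has_deriv_onB a b f g t l l' : has_deriv_on a b f t l ->
  has_deriv_on a b g t l' ->
  has_deriv_on a b (fun s => f s - g s) t (l - l').
Proof.
move=> H H'; have := has_deriv_onDZ (c := -1) H H'; rewrite scaleN1r.
by under [X in has_deriv_on _ _ X]funext do rewrite scaleN1r.
Qed.

Lemma has_deriv_on_sum a b (I : Type) (r : seq I) (c : I -> R)
    (F : I -> R -> V) (l : I -> V) t :
  (forall i, has_deriv_on a b (F i) t (l i)) ->
  has_deriv_on a b (fun s => \sum_(i <- r) c i *: F i s) t
    (\sum_(i <- r) c i *: l i).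
Proof.
move=> H; elim: r => [|i r IH].
  rewrite big_nil; under [X in has_deriv_on _ _ X]funext do rewrite big_nil.
  apply/has_deriv_onP => e e0; exists 1 => // s _ _.
  by rewrite scaler0 !subr0 normr0 mulr_ge0// ltW.
rewrite big_cons addrC.
under [X in has_deriv_on _ _ X]funext do rewrite big_cons addrC.
exact: has_deriv_onDZ.
Qed.

End OneSidedDerivative.

Section OneSidedDerivativeVector.
Variables (R : realType) (d : nat) (a b : R).
Implicit Type f : R -> 'cV[R]_d.

Lemma has_deriv_on_coord f t l k : has_deriv_on a b f t l ->
  has_deriv_on a b (fun s => f s k ord0) t (l k ord0).
Proof.
move=> /has_deriv_onP H; apply/has_deriv_onP => e /H[r r0 Hr].
exists r => // s sab st; apply: le_trans (Hr _ sab st).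
by apply: le_trans (mx_norm_ge_entry _ k ord0); rewrite !mxE.
Qed.

End OneSidedDerivativeVector.

(** * Gronwall estimates, first for scalars and then for vectors *)

Section Gronwall.
Variable R : realType.

Lemma within_has_deriv_on_continuous (T : R) (f df : R -> R) :
  (forall t, 0 <= t <= T -> has_deriv_on 0 T f t (df t)) ->
  {within `[0, T], continuous f}.
Proof.
move=> H; apply/subspace_continuousP => t; rewrite /= in_itv /= => tT.
apply/cvgrPdist_le => e e0.
have [r r0 Hr] := has_deriv_on_continuous (H t tT) e0.
apply/nbhs_ballP; exists r => //= s; rewrite /ball /= distrC => st.
by rewrite in_itv /= => sT; rewrite distrC; exact: Hr.
Qed.

(** Integrating factor: [v s = expR (- c * s) * u s - D * s] is nonincreasing, because its
    derivative is at most [D * (expR (- c * s) - 1)]. The bound is [v t <= v 0] solved for [u t]. *)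
Lemma gronwall_scalar (T c D : R) (u du : R -> R) : 0 <= c -> 0 <= D ->
  (forall t, 0 <= t <= T -> has_deriv_on 0 T u t (du t)) ->
  (forall t, 0 <= t <= T -> du t <= c * u t + D) ->
  forall t, 0 <= t <= T -> u t <= expR (c * T) * (`|u 0| + D * T).
Proof.
move=> c0 D0 Hu Hdu t tT.
have T0 : 0 <= T by move: tT; lra.
pose v (s : R) := expR (- c * s) * u s - D * s.
have dv s : 0 < s < T -> is_derive s (1 : R) v
   (expR (- c * s) * (du s - c * u s) - D).
  move=> sT; have du_ : is_derive s (1 : R) u (du s).
    by apply: (has_deriv_on_is_derive sT (Hu _ _)); move: sT; lra.
  have de : is_derive s (1 : R) (fun s => expR (- c * s)) (- c * expR (- c * s)).
    have -> : (fun s => expR (- c * s)) = expR \o ( *%R (- c)) by [].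
    apply: is_derive_eq.
    by rewrite /= /GRing.scale /= mulr1 mulrC.
  rewrite /v; apply: is_derive_eq.
  rewrite /GRing.scale /=; ring.
have cu := within_has_deriv_on_continuous Hu.
have cv : {within `[0, T], continuous v}.
  apply/subspace_continuousP => s sT.
  move/subspace_continuousP : cu => /(_ s sT) cus.
  apply: cvgB; [apply: cvgM => // | ]; apply: cvg_within_filter; last first.
    by apply: cvgMr; exact: cvg_id.
  have -> : (fun s => expR (- c * s)) = expR \o ( *%R (- c)) by [].
  apply: continuous_comp; last exact: continuous_expR.
  by apply: cvgMr; exact: cvg_id.
have vle : v t <= v 0.
  apply: (@ler0_derive1_nincr R v 0 T) => //; try by move: tT; lra.
    by move=> s; rewrite in_itv /= => sT; have := dv s sT; case.
  move=> s; rewrite in_itv /= => sT.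
  have := dv s sT; rewrite derive1E => -[_ ->].
  have sT' : 0 <= s <= T by move: sT; lra.
  have e1 : expR (- c * s) <= 1.
    rewrite -expR0 ler_expR mulNr oppr_le0 mulr_ge0//; by move: sT; lra.
  have := Hdu _ sT'; have := expR_ge0 (- c * s); move: e1 D0.
  set E := expR _; set a := u s; set b := du s => e1 D0 E0 H.
  have : E * (b - c * a) <= E * D by apply: ler_wpM2l => //; lra.
  by have : E * D <= 1 * D by [apply: ler_wpM2r]; lra.
move: vle; rewrite /v !mulr0 expR0 mul1r subr0 mulNr expRN => vle.
have E1 : expR (c * t) <= expR (c * T).
  by rewrite ler_expR ler_wpM2l//; move: tT; lra.
apply: (@le_trans _ _ (expR (c * t) * (u 0 + D * t))).
  by rewrite -ler_pdivrMl ?expR_gt0//; move: vle; lra.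
apply: (@le_trans _ _ (expR (c * t) * (`|u 0| + D * T))).
  rewrite ler_wpM2l ?expR_ge0// lerD ?ler_norm// ler_wpM2l//; by move: tT; lra.
by rewrite ler_wpM2r// addr_ge0// mulr_ge0.
Qed.

Lemma has_deriv_on_sqr (a b t l : R) (f : R -> R) : has_deriv_on a b f t l ->
  has_deriv_on a b (fun s => f s ^+ 2) t (2 * f t * l).
Proof.
move=> Hf; have /has_deriv_onP H := Hf; apply/has_deriv_onP => e e0.
have c0 : 0 < 4 * (1 + `|f t|) by rewrite mulr_gt0// ltr_pwDl.
have l0 : 0 < 1 + `|l| by rewrite ltr_pwDl.
have [|r r0 Hr] := H (e / (4 * (1 + `|f t|))); first by rewrite divr_gt0.
have [r1 r10 Hr1] := H 1 ltr01.
have [|r2 r20 Hr2] := has_deriv_on_continuous Hf (e := e / (2 * (1 + `|l|))).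
  by rewrite divr_gt0// mulr_gt0.
exists (Num.min r (Num.min r1 r2)); first by rewrite !lt_min r0 r10.
move=> s sab; rewrite !lt_min => /and3P[sr sr1 sr2].
move: (Hr _ sab sr) (Hr1 _ sab sr1) (Hr2 _ sab sr2).
rewrite /GRing.scale /=; set x := f s; set y := f t; set h := s - t => A B C.
(* The square is handled by continuity ([r2]) times a Lipschitz bound ([r1]), the other term by
   differentiability ([r]); each receives half of [e]. *)
have -> : x ^+ 2 - y ^+ 2 - h * (2 * y * l) =
  (x - y) * (x - y) + 2 * y * (x - y - h * l) by ring.
rewrite (le_trans (ler_normD _ _))// !normrM (ger0_norm (_ : (0 : R) <= 2))//.
have xy : `|x - y| <= (1 + `|l|) * `|h|.
  rewrite -[x - y](subrK (h * l)) (le_trans (ler_normD _ _))//.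
  by rewrite [leRHS]mulrDl lerD// normrM mulrC.
have E1 : `|x - y| * `|x - y| <= e / 2 * `|h|.
  apply: le_trans (ler_pM _ _ C xy) _ => //.
  by rewrite invfM mulrA mulrA divfK// gt_eqF.
have E2 : 2 * `|y| * `|x - y - h * l| <= e / 2 * `|h|.
  apply: le_trans (ler_wpM2l _ A) _; first by rewrite mulr_ge0.
  rewrite mulrA ler_wpM2r// mulrA ler_pdivrMr//.
  by have := normr_ge0 y; rewrite -/y; move: e0; nra.
lra.
Qed.

(** The max norm is not differentiable, so the scalar estimate is applied to the Euclidean square
    [u], which lies between [|w|^2] and [d |w|^2]. The constant depends on [d], [T] and [L] only,
    hence is uniform in [w] and in the source [e]. *)
Lemma gronwall (d : nat) (T L : R) : 0 <= L -> exists2 C : R, 0 <= C &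
  forall (e : R) (w dw : R -> 'cV[R]_d), 0 <= e ->
  (forall t, 0 <= t <= T -> has_deriv_on 0 T w t (dw t)) ->
  (forall t, 0 <= t <= T -> `|dw t| <= L * `|w t| + e) ->
  forall t, 0 <= t <= T -> `|w t| <= C * (`|w 0| + e).
Proof.
(* Each coordinate contributes [2 L u] to the derivative of [u], and [2 x e <= x^2 + e^2] accounts
   for the [1] in [c]. [D] bounds the squared norm, so [1 + D], whose square exceeds [D], serves for
   the norm. *)
move=> L0; pose c := 2 * d%:R * L + 1; pose D := expR (c * T) * (d%:R * (1 + T)).
have c0 : 0 <= c by rewrite addr_ge0// !mulr_ge0.
exists (1 + `|D|); first by rewrite addr_ge0.
move=> e w dw e0 Hw Hdw t tT; have T0 : 0 <= T by move: tT; lra.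
pose u (s : R) := \sum_(k < d) (1 : R) *: (w s k ord0) ^+ 2.
pose du (s : R) := \sum_(k < d) (1 : R) *: (2 * w s k ord0 * dw s k ord0).
have Hu s : 0 <= s <= T -> has_deriv_on 0 T u s (du s).
  move=> sT; apply: has_deriv_on_sum => k.
  by apply: has_deriv_on_sqr; apply: has_deriv_on_coord; exact: Hw.
have ule s : u s <= d%:R * `|w s| ^+ 2.
  rewrite /u (le_trans (ler_sum _ (G := fun=> `|w s| ^+ 2) _))//.
    move=> k _; rewrite scale1r -real_normK ?num_real// lerXn2r ?nnegrE//.
    exact: mx_norm_ge_entry.
  by rewrite sumr_const card_ord mulr_natl.
have leu s : `|w s| ^+ 2 <= u s.
  have [w0|/mx_norm_neq0[[k j] /= E]] := eqVneq (mx_norm (w s)) 0.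
    rewrite [`|w s|](_ : _ = mx_norm (w s))// w0 expr0n /=.
    by apply: sumr_ge0 => k _; rewrite scale1r sqr_ge0.
  rewrite [`|w s|](_ : _ = mx_norm (w s))// E real_normK ?num_real//.
  rewrite (ord1 j) /u (bigD1 k)//= scale1r lerDl.
  by apply: sumr_ge0 => i _; rewrite scale1r sqr_ge0.
have Hdu s : 0 <= s <= T -> du s <= c * u s + d%:R * e ^+ 2.
  move=> sT; have Hs := Hdw s sT.
  have -> : c * u s + d%:R * e ^+ 2 = \sum_(k < d) (2 * L * u s + (1 : R) *:
      (w s k ord0) ^+ 2 + e ^+ 2).
    rewrite !big_split /= -/(u s) !sumr_const card_ord.
    by rewrite -(mulr_natl (2 * L * u s)) -(mulr_natl (e ^+ 2)) /c; ring.
  apply: ler_sum => k _; rewrite !scale1r.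
  have A : `|w s k ord0| <= `|w s| by exact: mx_norm_ge_entry.
  have B : `|dw s k ord0| <= L * `|w s| + e.
    by apply: le_trans Hs; exact: mx_norm_ge_entry.
  have P : w s k ord0 * dw s k ord0 <= `|w s k ord0| * (L * `|w s| + e).
    by rewrite (le_trans (ler_norm _))// normrM ler_wpM2l.
  have Q : w s k ord0 ^+ 2 = `|w s k ord0| ^+ 2 by rewrite real_normK ?num_real.
  have := leu s; rewrite Q.
  have := normr_ge0 (w s k ord0); move: A P; set x := `|w s k ord0|; set y := `|w s|.
  move=> A P x0 S.
  have : L * (x * y) <= L * u s.
    by apply: ler_wpM2l => //; apply: le_trans S; rewrite expr2 ler_wpM2r// (le_trans x0).
  have := sqr_ge0 (x - e); nra.
have De : 0 <= d%:R * e ^+ 2 by rewrite mulr_ge0// sqr_ge0.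
have := gronwall_scalar c0 De Hu Hdu tT => U.
have u0 : `|u 0| <= d%:R * `|w 0| ^+ 2.
  by rewrite ger0_norm ?ule// (le_trans (sqr_ge0 `|w 0|)).
have D0 : 0 <= D by rewrite !mulr_ge0 ?expR_ge0// addr_ge0.
rewrite -(@ler_pXn2r _ 2)// ?nnegrE ?mulr_ge0 ?addr_ge0//.
rewrite (le_trans (leu t))// (le_trans U)//.
rewrite (ger0_norm D0).
have w0 := normr_ge0 (w 0).
apply: (@le_trans _ _ (D * (`|w 0| + e) ^+ 2)).
  rewrite /D -(mulrA (expR _)) ler_wpM2l ?expR_ge0//.
  apply: (@le_trans _ _ (d%:R * `|w 0| ^+ 2 + d%:R * e ^+ 2 * T)); first by rewrite lerD2r.
  rewrite -(mulrA d%:R (e ^+ 2)) -(mulrDr d%:R) -(mulrA d%:R (1 + T)) ler_wpM2l//.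
  have := sqr_ge0 `|w 0|; have := sqr_ge0 e; have := mulr_ge0 w0 e0.
  move: T0; set x := `|w 0|; nra.
rewrite exprMn ler_wpM2r ?sqr_ge0//; move: D0; nra.
Qed.

End Gronwall.

(** * Mean value and Taylor estimates from partial derivatives *)

Section CoordinateCalculus.
Variables (R : realType) (d : nat).
Implicit Types (x y v : 'cV[R]_d) (f : 'cV[R]_d -> R).

Lemma is_derive_line f x v (s l : R) : is_derive (x + s *: v) v f l ->
  is_derive s (1 : R) (fun r => f (x + r *: v)) l.
Proof.
move=> [/cvg_ex[l' /= Hl'] Hl].
have <- : l' = l by rewrite -Hl; apply/esym; exact: cvg_lim Hl'.
apply: cvg_is_derive; apply: cvg_trans Hl'; apply: near_eq_cvg; near=> h.
by rewrite /= scaler1 scalerDl addrCA.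
Unshelve. all: by end_near. Qed.

Lemma is_derive_translate f x v z (l : R) : is_derive (x - z) v f l ->
  is_derive x v (fun p => f (p - z)) l.
Proof.
move=> [/cvg_ex[l' /= Hl'] Hl].
have <- : l' = l by rewrite -Hl; apply/esym; exact: cvg_lim Hl'.
apply: cvg_is_derive; apply: cvg_trans Hl'; apply: near_eq_cvg; near=> h.
by rewrite /= addrA.
Unshelve. all: by end_near. Qed.

Lemma is_derive_coord x v k : is_derive x v (fun p => p k ord0) (v k ord0).
Proof.
apply: cvg_is_derive.
have : (cst (v k ord0) h @[h --> (0 : R)^'] --> v k ord0) by exact: cvg_cst.
apply: cvg_trans; apply: near_eq_cvg; near=> h.
rewrite !mxE addrK /GRing.scale /= mulrA mulVf ?mul1r//.
by near: h; exact: nbhs_dnbhs_neq.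
Unshelve. all: by end_near. Qed.

Lemma line_mean_value f (df : 'cV[R]_d -> R) x v (s M : R) :
  (forall p, is_derive p v f (df p)) ->
  (forall r, `|r| <= `|s| -> `|df (x + r *: v)| <= M) ->
  `|f (x + s *: v) - f x| <= M * `|s|.
Proof.
move=> Hf HM; pose g r := f (x + r *: v).
have Hg r : is_derive r (1 : R) g (df (x + r *: v)) by exact: is_derive_line.
have cg a b : {within `[a, b], continuous g}.
  apply: derivable_within_continuous => r _.
  by have := Hg r; case.
have -> : f x = g 0 by rewrite /g scale0r addr0.
rewrite -/(g s); have [s0|s0] := leP 0 s.
  have [c + ->] := MVT_segment s0 (fun r _ => Hg r) (cg _ _).
  rewrite in_itv /= subr0 normrM => cs; rewrite ler_wpM2r// HM//.
  by rewrite !ger0_norm//; move: cs; lra.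
have [c + E] := MVT_segment (ltW s0) (fun r _ => Hg r) (cg _ _).
rewrite in_itv /= distrC E sub0r normrM normrN => cs; rewrite ler_wpM2r// HM//.
by rewrite !ler0_norm//; move: cs; lra.
Qed.

(** Only partial derivatives are at hand, so the path from [x] to [y] changes one coordinate at a
    time. In the max norm it stays within [|y - x|] of [x], which is why the derivative bound is
    asked on that ball only. *)
Lemma mean_value f (df : 'I_d -> 'cV[R]_d -> R) x y (M : R) :
  (forall a p, is_derive p (ebasis R a) f (df a p)) ->
  (forall a p, `|p - x| <= `|y - x| -> `|df a p| <= M) ->
  `|f y - f x| <= d%:R * M * `|y - x|.
Proof.
move=> Hf HM.
(* [z n] has its first [n] coordinates from [y] and the others from [x]. *)
pose z n : 'cV[R]_d := \col_i (if (i < n)%N then y i ord0 else x i ord0).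
have z0 : z 0%N = x.
  by apply/matrixP => i j; rewrite mxE ltn0 (ord1 j).
have zd : z d = y.
  by apply/matrixP => i j; rewrite mxE ltn_ord (ord1 j).
have zS (k : 'I_d) : z k.+1 = z k + (y k ord0 - x k ord0) *: ebasis R k.
  apply/matrixP => i j; rewrite !mxE (ord1 j) eqxx andbT ltnS leq_eqVlt.
  have [->|ik] := eqVneq i k; first by rewrite eqxx ltnn /= mulr1 subrKC.
  by rewrite (inj_eq val_inj) (negbTE ik) /= mulr0 addr0.
have -> : f y - f x = \sum_(k < d) (f (z k.+1) - f (z k)).
  by rewrite -(big_mkord xpredT (fun k => f (z k.+1) - f (z k)))
    (telescope_sumr (fun k => f (z k)) (leq0n d)) zd z0.
rewrite (le_trans (ler_norm_sum _ _ _))//.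
rewrite (le_trans (ler_sum _ (G := fun=> M * `|y - x|) _))//; last first.
  by rewrite sumr_const card_ord -(mulr_natl (M * _)) mulrA.
move=> k _; have yx : `|y k ord0 - x k ord0| <= `|y - x|.
  by have := mx_norm_ge_entry (y - x) k ord0; rewrite !mxE.
have M0 : 0 <= M.
  by apply: le_trans (HM k x _); rewrite // subrr normr0.
rewrite zS (le_trans (line_mean_value (M := M) (Hf k) _))//; last first.
  by rewrite ler_wpM2l.
move=> r rs; apply: HM; apply: mx_norm_le => // i j.
rewrite !mxE (ord1 j) eqxx andbT.
have [->|ik] := eqVneq i k.
  by rewrite ltnn mulr1 addrAC subrr add0r (le_trans rs).
rewrite mulr0 addr0; case: ifP => _; last by rewrite subrr normr0.
by have := mx_norm_ge_entry (y - x) i ord0; rewrite !mxE.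
Qed.

(** Two uses of [mean_value]: on [f] minus its linear part at [x], whose partial derivatives are
    [df a p - df a x], and then on each [df a] to see that these are at most [d M |y - x|] on the
    ball. *)
Lemma taylor2 f (df : 'I_d -> 'cV[R]_d -> R) (ddf : 'I_d -> 'I_d -> 'cV[R]_d -> R)
    x y (M : R) :
  (forall a p, is_derive p (ebasis R a) f (df a p)) ->
  (forall a b p, is_derive p (ebasis R b) (df a) (ddf a b p)) ->
  (forall a b p, `|ddf a b p| <= M) ->
  `|f y - f x - \sum_a (y - x) a ord0 * df a x| <= d%:R ^+ 2 * M * `|y - x| ^+ 2.
Proof.
move=> Hf Hdf HM.
pose g p := f p - \sum_a df a x *: p a ord0.
have Hg b p : is_derive p (ebasis R b) g (df b p - df b x).
  have -> : df b p - df b x =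
      df b p - \sum_a df a x *: (ebasis R b a ord0).
    congr (_ - _); rewrite (bigD1 b)//= big1 ?addr0 => [|a ab].
      by rewrite mxE !eqxx /GRing.scale /= mulr1.
    by rewrite mxE (negbTE ab) /= scaler0.
  have -> : g = f - \sum_a (df a x \*: (fun p : 'cV[R]_d => p a ord0)).
    apply/funext => q; rewrite /g fctE; congr (_ - _).
    by rewrite fct_sumE.
  apply: is_deriveB; apply: is_derive_sum => a.
  by apply: is_deriveZ; exact: is_derive_coord.
rewrite (_ : _ - _ = g y - g x); last first.
  have -> : \sum_a (y - x) a ord0 * df a x =
      \sum_a df a x *: y a ord0 - \sum_a df a x *: x a ord0.
    by rewrite -sumrB; apply: eq_bigr => a _; rewrite !mxE /GRing.scale /=; ring.
  by rewrite /g; ring.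
rewrite (le_trans (mean_value (M := d%:R * M * `|y - x|) Hg _))//; last first.
  by rewrite le_eqVlt; apply/orP; left; apply/eqP; ring.
(* A negative [M] is excluded as soon as there is a coordinate [b]; in dimension zero this point is
   never reached. *)
move=> b p pxy; have [M0|M0] := leP 0 M; last first.
  by have := HM b b p; rewrite leNgt (lt_le_trans M0).
rewrite (le_trans (mean_value (M := M) (Hdf b) _))// ler_wpM2l// mulr_ge0//.
Qed.

End CoordinateCalculus.

(** * Uniqueness and differentiability of the flow of a field with quadratic Taylor remainder *)

Section FlowRegularity.
Variables (R : realType) (d : nat).

(* [A t x a] plays the role of the partial derivative of [b t] at [x] in
   direction [a]; no derivative of [b] is mentioned because only the quadratic
   remainder bound matters. *)
Definition C11_field (T L : R) (b : R -> 'cV[R]_d -> 'cV[R]_d)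
    (A : R -> 'cV[R]_d -> 'I_d -> 'cV[R]_d) : Prop :=
  forall t, 0 <= t <= T ->
  [/\ forall x y, `|b t x - b t y| <= L * `|x - y|,
      forall x a, `|A t x a| <= L &
      forall x y, `|b t y - b t x - \sum_a (y - x) a ord0 *: A t x a| <=
        L * `|y - x| ^+ 2].

Variables (T L : R) (b : R -> 'cV[R]_d -> 'cV[R]_d).
Variables (A : R -> 'cV[R]_d -> 'I_d -> 'cV[R]_d).
Hypotheses (L0 : 0 <= L) (bA : C11_field T L b A).
Variable phi : R -> 'cV[R]_d -> 'cV[R]_d.
Hypothesis phiP : is_flow T b phi.

(** Gronwall with zero source, applied to the difference of two trajectories. *)
Lemma flow_lipschitz : exists2 C : R, 0 <= C &
  forall t x y, 0 <= t <= T -> `|phi t x - phi t y| <= C * `|x - y|.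
Proof.
have [C C0 HC] := gronwall d T L0; exists C => // t x y tT.
have [x0 Hx] := phiP x; have [y0 Hy] := phiP y.
have := HC 0 (fun s => phi s x - phi s y)
  (fun s => b s (phi s x) - b s (phi s y)) (lexx _).
rewrite x0 y0 addr0; apply => // s sT.
  by apply: has_deriv_onB; [exact: Hx | exact: Hy].
by rewrite addr0; have [+ _ _] := bA sT; exact.
Qed.

Lemma flow_unique (g : R -> 'cV[R]_d) :
  (forall t, 0 <= t <= T -> has_deriv_on 0 T g t (b t (g t))) ->
  forall t, 0 <= t <= T -> g t = phi t (g 0).
Proof.
move=> Hg t tT; have [C C0 HC] := gronwall d T L0.
have [x0 Hx] := phiP (g 0).
have := HC 0 (fun s => g s - phi s (g 0))
  (fun s => b s (g s) - b s (phi s (g 0))) (lexx _).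
rewrite x0 subrr normr0 addr0 mulr0 => H.
apply/eqP; rewrite -subr_eq0 -normr_le0; apply: H => // s sT.
  by apply: has_deriv_onB; [exact: Hg | exact: Hx].
by rewrite addr0; have [+ _ _] := bA sT; exact.
Qed.

Lemma mx_norm_lincomb (v : 'cV[R]_d) (F : 'I_d -> 'cV[R]_d) (M : R) :
  (forall a, `|F a| <= M) -> `|\sum_a v a ord0 *: F a| <= d%:R * M * `|v|.
Proof.
move=> FM; rewrite (le_trans (ler_norm_sum _ _ _))//.
rewrite (le_trans (ler_sum _ (G := fun=> M * `|v|) _))//; last first.
  by rewrite sumr_const card_ord -(mulr_natl (M * _)) mulrA.
move=> a _; rewrite normrZ mulrC ler_pM//; exact: mx_norm_ge_entry.
Qed.

(* An affine relation between initial points is preserved by the flow up to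
   second order: the defect solves the linearised equation with a quadratic
   source. Existence, linearity and regularity of the derivative of the flow all
   follow by choosing the relation. *)
Lemma flow_second_order : exists2 C : R, 0 <= C &
  forall (I : finType) (c : I -> R) (y : I -> 'cV[R]_d) x t, 0 <= t <= T ->
  \sum_i c i *: (y i - x) = 0 ->
  `|\sum_i c i *: (phi t (y i) - phi t x)| <=
    C * \sum_i `|c i| * `|y i - x| ^+ 2.
Proof.
have dL0 : 0 <= d%:R * L by rewrite mulr_ge0.
have [G G0 HG] := gronwall d T dL0; have [C C0 HC] := flow_lipschitz.
exists (G * (L * C ^+ 2)); first by rewrite !mulr_ge0// sqr_ge0.
move=> I c y x t tT cy0.
pose S := \sum_i `|c i| * `|y i - x| ^+ 2.
have S0 : 0 <= S by apply: sumr_ge0 => i _; rewrite mulr_ge0// sqr_ge0.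
have := HG (L * C ^+ 2 * S) (fun s => \sum_i c i *: (phi s (y i) - phi s x))
  (fun s => \sum_i c i *: (b s (phi s (y i)) - b s (phi s x))).
have -> : \sum_i c i *: (phi 0 (y i) - phi 0 x) = 0.
  apply: etrans cy0; apply: eq_bigr => i _.
  by have [-> _] := phiP (y i); have [-> _] := phiP x.
rewrite normr0 add0r -[G * (L * _) * _]mulrA -/S => H; apply: H => //.
- by rewrite !mulr_ge0// sqr_ge0.
- move=> s sT; apply: has_deriv_on_sum => i; apply: has_deriv_onB.
    by have [_] := phiP (y i); exact.
  by have [_] := phiP x; exact.
move=> s sT; have [_ HA HB] := bA sT.
(* Expanding [b s] at [phi s x], the linear parts recombine into the linearised operator acting on
   the defect itself. What remains is a sum of quadratic remainders, bounded in terms of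
   [|y i - x|^2] by [flow_lipschitz]. *)
pose r i := b s (phi s (y i)) - b s (phi s x) -
  \sum_a (phi s (y i) - phi s x) a ord0 *: A s (phi s x) a.
rewrite (_ : \sum_i _ = \sum_a (\sum_i c i *: (phi s (y i) - phi s x)) a ord0 *:
    A s (phi s x) a + \sum_i c i *: r i); last first.
  rewrite (eq_bigr (fun i => c i *: r i + \sum_a (c i * (phi s (y i) - phi s x) a ord0)
      *: A s (phi s x) a)); last first.
    move=> i _; under [X in _ = _ + X]eq_bigr do rewrite -scalerA.
    by rewrite -scaler_sumr -scalerDr subrK.
  rewrite big_split /= addrC; congr (_ + _); rewrite exchange_big /=.
  apply: eq_bigr => a _; rewrite -scaler_suml summxE; congr (_ *: _).
  by apply: eq_bigr => i _; rewrite [RHS]mxE.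
rewrite (le_trans (ler_normD _ _))// lerD//; first exact: mx_norm_lincomb.
rewrite (le_trans (ler_norm_sum _ _ _))// mulr_sumr; apply: ler_sum => i _.
rewrite normrZ [leRHS]mulrCA ler_wpM2l// (le_trans (HB _ _))// -mulrA ler_wpM2l//.
by rewrite -exprMn lerXn2r ?nnegrE ?mulr_ge0// HC.
Qed.

Definition flow_quot t x a (h : R) : 'cV[R]_d :=
  h^-1 *: (phi t (h *: ebasis R a + x) - phi t x).

Lemma norm_ebasis_le1 a : `|ebasis R a : 'cV[R]_d| <= 1.
Proof.
apply: mx_norm_le => // i j; rewrite mxE.
by case: (_ && _); rewrite ?normr1 ?normr0.
Qed.

(** The difference quotients for steps [k] and [l] differ by at most [C (|k| + |l|)]. By
    completeness they converge, and letting [k] tend to 0 gives a rate that is uniform in [t] and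
    [x]. *)
Lemma flow_derive : exists2 C : R, 0 <= C & forall t x a h, 0 <= t <= T ->
  h != 0 -> `|flow_quot t x a h - 'D_(ebasis R a) (phi t) x| <= C * `|h|.
Proof.
have [C C0 HC] := flow_second_order; exists C => // t x a h tT h0.
(* The relation used has the two points [x + k e_a] and [x + l e_a] with weights [1/k] and [-1/l],
   so that the weighted displacements cancel. *)
have HQ (k l : R) : k != 0 -> l != 0 ->
    `|flow_quot t x a k - flow_quot t x a l| <= C * (`|k| + `|l|).
  move=> k0 l0.
  have := HC bool (fun i => if i then k^-1 else - l^-1)
    (fun i => (if i then k else l) *: ebasis R a + x) x t tT.
  rewrite !big_bool /= !addrK !scalerA mulNr !mulVf// scaleN1r scale1r subrr.
  move=> /(_ erefl); rewrite scaleNr -/(flow_quot t x a k) -/(flow_quot t x a l).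
  move=> /le_trans; apply; rewrite ler_wpM2l// lerD// ?normrN normrZ normfV.
    rewrite ler_pdivrMl ?normr_gt0// -expr2 lerXn2r ?nnegrE ?mulr_ge0//.
    by rewrite ler_piMr// norm_ebasis_le1.
  rewrite ler_pdivrMl ?normr_gt0// -expr2 lerXn2r ?nnegrE ?mulr_ge0//.
  by rewrite ler_piMr// norm_ebasis_le1.
have : cvg (flow_quot t x a @ (0 : R)^').
  apply/cauchy_cvgP/cauchy_exP => e e0.
  pose r := e / (2 * (1 + C)).
  have C1 : 0 < 1 + C by rewrite ltr_pwDl.
  have r0 : 0 < r by rewrite divr_gt0// mulr_gt0.
  exists (flow_quot t x a (r / 2)); rewrite /fmap /=.
  apply/nbhs_ballP; exists r => //= k + k0.
  rewrite -!ball_normE /= sub0r normrN => kr.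
  have r20 : 0 < r / 2 by rewrite divr_gt0.
  apply: le_lt_trans (HQ _ _ _ k0) _; first by rewrite gt_eqF.
  rewrite (gtr0_norm r20).
  apply: (@le_lt_trans _ _ (C * (2 * r))).
    by rewrite ler_wpM2l//; move: kr r0; lra.
  have -> : C * (2 * r) = e * (C / (1 + C)) by rewrite /r; field; rewrite gt_eqF.
  by rewrite gtr_pMr// ltr_pdivrMr// mul1r ltrDr.
move=> /cvg_ex[D HD].
have -> : 'D_(ebasis R a) (phi t) x = D by exact: cvg_lim HD.
apply/ler_addgt0Pr => e e0.
pose r := e / (1 + C).
have C1 : 0 < 1 + C by rewrite ltr_pwDl.
have r0 : 0 < r by rewrite divr_gt0.
have Dk : \forall k \near (0 : R)^', `|D - flow_quot t x a k| <= r.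
  by move/cvgrPdist_le : HD; exact.
have : \forall k \near (0 : R)^', `|flow_quot t x a h - D| <= C * `|h| + e.
  near=> k.
  have k0 : k != 0 by near: k; exact: nbhs_dnbhs_neq.
  have kr : `|k| <= r by near: k; exact: dnbhs0_le.
  have Dkr : `|D - flow_quot t x a k| <= r by near: k.
  have Q := HQ h k h0 k0.
  have -> : flow_quot t x a h - D =
    (flow_quot t x a h - flow_quot t x a k) - (D - flow_quot t x a k).
    by rewrite opprB addrA subrK.
  rewrite (le_trans (ler_normB _ _))//.
  have E : C * r + r = e by rewrite /r; field; rewrite gt_eqF.
  rewrite (le_trans (lerD Q Dkr))// mulrDr -addrA lerD2l -[leRHS]E lerD2r.
  by rewrite ler_wpM2l.
by move=> /filter_ex[].
Unshelve. all: by end_near. Qed.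

(** The point [x + u] with weight 1 and the points [x + h e_a] with weights [- u_a / h] satisfy an
    affine relation. [flow_second_order] thus compares the increment of the flow with a combination
    of difference quotients, and small [h] replaces these by derivatives. *)
Lemma flow_taylor : exists2 C : R, 0 <= C & forall t x u, 0 <= t <= T ->
  `|phi t (x + u) - phi t x - \sum_a u a ord0 *: 'D_(ebasis R a) (phi t) x| <=
    C * `|u| ^+ 2.
Proof.
have [C C0 HC] := flow_second_order; have [D D0 HD] := flow_derive.
exists C => // t x u tT; apply/ler_addgt0Pr => e e0.
(* [B h] is the total error of first order in [h]: the part of the second-order bound due to the
   points [x + h e_a], plus the replacement of quotients by derivatives. *)
pose B := C * d%:R * `|u| + d%:R * D * `|u|.
have B0 : 0 <= B by rewrite addr_ge0// !mulr_ge0.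
have B1 : 0 < 1 + B by rewrite ltr_pwDl.
have [h h0 hE] : exists2 h, 0 < h & B * h + h = e.
  exists (e / (1 + B)); first by rewrite divr_gt0.
  by field; rewrite gt_eqF.
have hN0 : h != 0 by rewrite gt_eqF.
have uE : \sum_a u a ord0 *: ebasis R a = u.
  apply/matrixP => i j; rewrite summxE (ord1 j) (bigD1 i)//= big1 ?addr0.
    by rewrite !mxE !eqxx mulr1.
  by move=> a ai; rewrite !mxE eq_sym (negbTE ai) /= mulr0.
have H1 : `|phi t (x + u) - phi t x - \sum_a u a ord0 *: flow_quot t x a h| <=
    C * (`|u| ^+ 2 + d%:R * `|u| * h).
  (* Index [ord0] stands for [x + u], the remaining [d] indices for the coordinate directions. *)
  have := HC 'I_d.+1 (fun i => if unlift ord0 i is Some a then - (u a ord0 / h) else 1)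
    (fun i => if unlift ord0 i is Some a then h *: ebasis R a + x else x + u) x t tT.
  rewrite !big_ord_recl /= unlift_none !scale1r normr1 mul1r.
  rewrite [x + u]addrC addrK.
  have -> : \sum_(i < d) (if unlift ord0 (lift ord0 i) is Some a
      then - (u a ord0 / h) else 1) *: ((if unlift ord0 (lift ord0 i) is Some a
      then h *: ebasis R a + x else u + x) - x) = - u.
    rewrite -[in RHS]uE -sumrN; apply: eq_bigr => a _.
    by rewrite liftK addrK scalerA mulNr divfK// scaleNr.
  rewrite subrr => /(_ erefl).
  have -> : \sum_(i < d) (if unlift ord0 (lift ord0 i) is Some a
      then - (u a ord0 / h) else 1) *: (phi t (if unlift ord0 (lift ord0 i) is Some a
      then h *: ebasis R a + x else u + x) - phi t x) =
      - \sum_a u a ord0 *: flow_quot t x a h.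
    rewrite -sumrN; apply: eq_bigr => a _.
    by rewrite liftK /flow_quot scalerA scaleNr.
  move=> /le_trans; apply; rewrite ler_wpM2l// lerD2l.
  rewrite (le_trans (ler_sum _ (G := fun=> `|u| * h) _))//; last first.
    by rewrite sumr_const card_ord -(mulr_natl (`|u| * _)) mulrA.
  move=> a _; rewrite liftK addrK normrN normrM normfV normrZ (gtr0_norm h0).
  rewrite -mulrA ler_pM// ?mulr_ge0 ?invr_ge0 ?sqr_ge0 ?(ltW h0)//.
    exact: mx_norm_ge_entry.
  rewrite ler_pdivrMl// -expr2 lerXn2r ?nnegrE ?mulr_ge0 ?(ltW h0)//.
  by rewrite ler_piMr ?norm_ebasis_le1// ltW.
have H2 : `|\sum_a u a ord0 *: (flow_quot t x a h - 'D_(ebasis R a) (phi t) x)| <=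
    d%:R * (D * h) * `|u|.
  by apply: mx_norm_lincomb => a; rewrite -{2}(gtr0_norm h0) HD.
have -> : phi t (x + u) - phi t x - \sum_a u a ord0 *: 'D_(ebasis R a) (phi t) x =
  (phi t (x + u) - phi t x - \sum_a u a ord0 *: flow_quot t x a h) +
  \sum_a u a ord0 *: (flow_quot t x a h - 'D_(ebasis R a) (phi t) x).
  under [X in _ = _ + X]eq_bigr do rewrite scalerBr.
  by rewrite sumrB addrA subrK.
rewrite (le_trans (ler_normD _ _))// (le_trans (lerD H1 H2))//.
rewrite -[e]hE /B; move: (ltW h0); set x1 := `|u|; nra.
Qed.

(* Comparing the Taylor expansions of the three increments x' - x,
   x' - x + h e_a (both at x) and h e_a (at x'), with h = |x' - x|. *)
Lemma flow_derive_lipschitz : exists2 C : R, 0 <= C & forall t x x' a,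
  0 <= t <= T ->
  `|'D_(ebasis R a) (phi t) x' - 'D_(ebasis R a) (phi t) x| <= C * `|x' - x|.
Proof.
(* [6 = 2^2 + 1 + 1]: the increments are at most [2 h], [h] and [h]. *)
have [C C0 HC] := flow_taylor; exists (6 * C); first by rewrite mulr_ge0.
move=> t x x' a tT; have [->|xx'] := eqVneq x' x.
  by rewrite !subrr !normr0 mulr0.
set h := `|x' - x|.
have h0 : 0 < h by rewrite normr_gt0 subr_eq0.
pose D y := 'D_(ebasis R a) (phi t) y.
have E y : \sum_k (h *: ebasis R a) k ord0 *: 'D_(ebasis R k) (phi t) y = h *: D y.
  rewrite (bigD1 a)//= big1 ?addr0 => [|k ka]; rewrite !mxE ?eqxx ?mulr1//.
  by rewrite (negbTE ka) mulr0 scale0r.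
have N1 := HC t x (x' - x) tT.
have N2 := HC t x (x' - x + h *: ebasis R a) tT.
have N3 := HC t x' (h *: ebasis R a) tT.
have he : `|h *: ebasis R a| <= h.
  by rewrite normrZ (gtr0_norm h0) ler_piMr ?norm_ebasis_le1// ltW.
have he2 : `|x' - x + h *: ebasis R a| <= 2 * h.
  by rewrite (le_trans (ler_normD _ _))// mulr2n mulrDl mul1r lerD.
have S : \sum_k (x' - x + h *: ebasis R a) k ord0 *: 'D_(ebasis R k) (phi t) x =
  \sum_k (x' - x) k ord0 *: 'D_(ebasis R k) (phi t) x + h *: D x.
  rewrite -E -big_split /=; apply: eq_bigr => k _.
  by rewrite -scalerDl; congr (_ *: _); rewrite mxE.
move: N1 N2 N3; rewrite S E [x + (_ + _ *: _)]addrA ![x + (x' - x)]addrC subrK.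
set p := phi t (x' + _); set q := phi t x'; set s := phi t x.
set W := \sum_k _ => N1 N2 N3.
have : `|h *: (D x' - D x)| <= C * (2 * h) ^+ 2 + C * h ^+ 2 + C * h ^+ 2.
  have -> : h *: (D x' - D x) =
    (p - s - (W + h *: D x)) - (q - s - W) - (p - q - h *: D x').
    by apply/matrixP => i j; rewrite !mxE; ring.
  rewrite (le_trans (ler_normB _ _))// lerD//; last first.
    rewrite (le_trans N3)// ler_wpM2l// lerXn2r ?nnegrE// ltW//.
  rewrite (le_trans (ler_normB _ _))// lerD//.
  rewrite (le_trans N2)// ler_wpM2l// lerXn2r ?nnegrE// mulr_ge0// ltW//.
rewrite normrZ (gtr0_norm h0) -[leRHS](_ : h * (6 * C * h) = _); last by ring.
by rewrite ler_pM2l.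
Qed.

(** The derivative is compared with the difference quotient of step 1, which the Lipschitz bound
    controls. *)
Lemma flow_derive_bounded : exists2 C : R, 0 <= C & forall t x a,
  0 <= t <= T -> `|'D_(ebasis R a) (phi t) x| <= C.
Proof.
have [C C0 HC] := flow_lipschitz; have [D D0 HD] := flow_derive.
exists (C + D); first by rewrite addr_ge0.
move=> t x a tT; have := HD t x a 1 tT (oner_neq0 _).
rewrite normr1 mulr1 => H.
have Q : `|flow_quot t x a 1| <= C.
  rewrite /flow_quot invr1 !scale1r (le_trans (HC _ _ _ tT))// addrK.
  by rewrite ler_piMr// norm_ebasis_le1.
rewrite -[X in `|X|](subKr (flow_quot t x a 1)) (le_trans (ler_normB _ _))//.
by rewrite lerD.
Qed.

(** The quadratic Taylor bound for [phi t] plays the role of total differentiability. With [u] the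
    increment of [g], one factor of [|u|^2] is small by continuity and the other is at most
    [(1 + |l|) |q - s|]. *)
Lemma flow_chain_rule (g : R -> 'cV[R]_d) (a0 b0 s t : R) (l : 'cV[R]_d) :
  0 <= t <= T -> has_deriv_on a0 b0 g s l ->
  has_deriv_on a0 b0 (fun r => phi t (g r)) s
    (\sum_a l a ord0 *: 'D_(ebasis R a) (phi t) (g s)).
Proof.
move=> tT Hg; have [C C0 HC] := flow_taylor; have [D D0 HD] := flow_derive_bounded.
have /has_deriv_onP H := Hg; apply/has_deriv_onP => e e0.
(* [c1] pays for the remainder of [g] seen through the bounded derivative of the flow, [c2] for the
   Taylor remainder; each yields [e / 2]. *)
pose c1 := 2 * (1 + d%:R * D); pose c2 := 2 * (1 + C * (1 + `|l|)).
have c10 : 0 < c1 by rewrite mulr_gt0// ltr_pwDl// mulr_ge0.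
have c20 : 0 < c2 by rewrite mulr_gt0// ltr_pwDl// mulr_ge0// addr_ge0.
have [|r r0 Hr] := H (e / c1); first by rewrite divr_gt0.
have [r1 r10 Hr1] := H 1 ltr01.
have [|r2 r20 Hr2] := has_deriv_on_continuous Hg (e := e / c2).
  by rewrite divr_gt0.
exists (Num.min r (Num.min r1 r2)); first by rewrite !lt_min r0 r10.
move=> q qab; rewrite !lt_min => /and3P[sr sr1 sr2].
move: (Hr _ qab sr) (Hr1 _ qab sr1) (Hr2 _ qab sr2); rewrite mul1r.
set k := q - s; set u := g q - g s => A1 A2 A3.
have := HC t (g s) u tT; rewrite [g s + u]addrC subrK => HT.
have -> : phi t (g q) - phi t (g s) -
    k *: (\sum_a l a ord0 *: 'D_(ebasis R a) (phi t) (g s)) =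
  (phi t (g q) - phi t (g s) - \sum_a u a ord0 *: 'D_(ebasis R a) (phi t) (g s)) +
  \sum_a (u - k *: l) a ord0 *: 'D_(ebasis R a) (phi t) (g s).
  rewrite -[RHS]addrA; congr (_ + _); rewrite scaler_sumr -!sumrN -big_split /=.
  by apply: eq_bigr => a _; apply/matrixP => i j; rewrite !mxE; ring.
rewrite (le_trans (ler_normD _ _))// [e in leRHS]splitr mulrDl lerD//.
  rewrite (le_trans HT)//.
  have uk : `|u| <= (1 + `|l|) * `|k|.
    rewrite -[u](subrK (k *: l)) (le_trans (ler_normD _ _))//.
    by rewrite [leRHS]mulrDl mul1r lerD// normrZ mulrC.
  have u2 : `|u| ^+ 2 <= e / c2 * ((1 + `|l|) * `|k|) by rewrite expr2 ler_pM.
  rewrite (le_trans (ler_wpM2l C0 u2))//.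
  rewrite (_ : C * _ = e * (C * (1 + `|l|) / c2) * `|k|); last by ring.
  rewrite ler_wpM2r// ler_wpM2l ?(ltW e0)// ler_pdivrMr//.
  by rewrite /c2 mulKf// lerDr.
rewrite (le_trans (mx_norm_lincomb _ (fun a => HD t (g s) a tT)))//.
rewrite (le_trans (ler_wpM2l _ A1)) ?mulr_ge0// mulrA ler_wpM2r//.
rewrite mulrCA ler_wpM2l ?(ltW e0)// ler_pdivrMr//.
by rewrite /c1 mulKf// lerDr.
Qed.

End FlowRegularity.

(** * Test fields in the max norm and the dual of bounded Lipschitz fields *)

Section TestFunctions.
Variables (R : realType) (d : nat).
Implicit Types (theta : 'cV[R]_d -> 'cV[R]_d) (xi : current R d).

Lemma enorm_ge_mx_norm (v : 'cV[R]_d) : `|v| <= enorm v.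
Proof.
apply: mx_norm_le => [|i j]; first exact: sqrtr_ge0.
rewrite (ord1 j) -sqrtr_sqr ler_wsqrtr// expr2 /edot (bigD1 i)//= lerDl.
by apply: sumr_ge0 => k _; rewrite -expr2 sqr_ge0.
Qed.

Lemma enorm_le_mx_norm (v : 'cV[R]_d) : enorm v <= d%:R * `|v|.
Proof.
have dv : 0 <= d%:R * `|v| by rewrite mulr_ge0.
rewrite -[leRHS](ger0_norm dv) -sqrtr_sqr ler_wsqrtr// exprMn.
rewrite (@le_trans _ _ (d%:R * `|v| ^+ 2))//; last first.
  by rewrite ler_wpM2r ?sqr_ge0// -natrX ler_nat; case: d => // n; rewrite leq_pmulr.
rewrite /edot (le_trans (ler_sum _ (G := fun=> `|v| ^+ 2) _))//; last first.
  by rewrite sumr_const card_ord -(mulr_natl (`|v| ^+ 2)).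
move=> k _; rewrite -expr2 -real_normK ?num_real// lerXn2r ?nnegrE//.
exact: mx_norm_ge_entry.
Qed.

Lemma CbP theta : Cb theta <->
  continuous theta /\ exists M : R, forall x, `|theta x| <= M.
Proof.
split=> -[ct [M HM]]; split => //.
  by exists M => x; rewrite (le_trans (enorm_ge_mx_norm _)).
exists (d%:R * M) => x.
by rewrite (le_trans (enorm_le_mx_norm _))// ler_wpM2l.
Qed.

Lemma lipschitz_continuous (V W : normedModType R) (f : V -> W) (m : R) :
  (forall x y, `|f x - f y| <= m * `|x - y|) -> continuous f.
Proof.
move=> H x; apply/cvgrPdist_le => e e0.
have m1 : 0 < 1 + `|m| by rewrite ltr_pwDl.
near=> y; rewrite (le_trans (H _ _))//.
have : `|x - y| <= e / (1 + `|m|).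
  by near: y; apply: cvgr_dist_le; rewrite ?divr_gt0//; exact: cvg_id.
rewrite ler_pdivlMr// => He; rewrite (le_trans _ He)// mulrC ler_wpM2l//.
by rewrite (le_trans (ler_norm _))// lerDr.
Unshelve. all: by end_near. Qed.

Lemma lipschitz_Cb theta (M m : R) : (forall x, `|theta x| <= M) ->
  (forall x y, `|theta x - theta y| <= m * `|x - y|) -> Cb theta.
Proof.
move=> tM tm; apply/CbP; split; last by exists M.
exact: lipschitz_continuous tm.
Qed.

Lemma CbDZ theta1 theta2 (c : R) : Cb theta1 -> Cb theta2 ->
  Cb (fun x => theta1 x + c *: theta2 x).
Proof.
move=> /CbP[c1 [M1 H1]] /CbP[c2 [M2 H2]]; apply/CbP; split.
  by move=> x; exact: (cvgD (c1 x) (cvgZ (cvg_cst c) (c2 x))).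
exists (M1 + `|c| * M2) => x; rewrite (le_trans (ler_normD _ _))// lerD//.
by rewrite normrZ ler_wpM2l.
Qed.

Definition Cb_linear xi := forall theta1 theta2 (a : R),
  Cb theta1 -> Cb theta2 ->
  xi (fun x => theta1 x + a *: theta2 x) = xi theta1 + a * xi theta2.

(** Up to constants, the dual norm of bounded Lipschitz fields, in the max norm; one [m] bounds both
    the size and the Lipschitz constant. *)
Definition BL_bounded (B : R) xi := forall theta (m : R),
  (forall x, `|theta x| <= m) ->
  (forall x y, `|theta x - theta y| <= m * `|x - y|) -> `|xi theta| <= B * m.

(** Membership in [Cb] is proved together with the identity, since the next induction step applies
    linearity to the partial sum. *)
Lemma Cb_linear_sum xi (I : Type) (r : seq I) (c : I -> R) theta
    (psi : I -> 'cV[R]_d -> 'cV[R]_d) :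
  Cb_linear xi -> Cb theta -> (forall i, Cb (psi i)) ->
  Cb (fun x => theta x + \sum_(i <- r) c i *: psi i x) /\
  xi (fun x => theta x + \sum_(i <- r) c i *: psi i x) =
    xi theta + \sum_(i <- r) c i * xi (psi i).
Proof.
move=> lxi Ct Cp; elim: r => [|i r [IH1 IH2]].
  rewrite big_nil addr0 (_ : (fun x => _) = theta)//.
  by apply/funext => x; rewrite big_nil addr0.
rewrite (_ : (fun x => _) = fun x =>
    (theta x + \sum_(i <- r) c i *: psi i x) + c i *: psi i x); last first.
  by apply/funext => x; rewrite big_cons addrA addrAC.
split; first exact: CbDZ.
by rewrite lxi// IH2 big_cons addrA addrAC.
Qed.

End TestFunctions.

(** * Scalar kernels: Lipschitz and Taylor bounds, jointly in both variables of [k (x - y)] *)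

Section KernelEstimates.
Variables (R : realType) (d : nat) (M : R) (k : 'cV[R]_d -> R).
Variables (k1 : 'I_d -> 'cV[R]_d -> R) (k2 : 'I_d -> 'I_d -> 'cV[R]_d -> R).
Variables (k3 : 'I_d -> 'I_d -> 'I_d -> 'cV[R]_d -> R).
Hypotheses (M0 : 0 <= M).
Hypothesis dk : forall a p, is_derive p (ebasis R a) k (k1 a p).
Hypothesis dk1 : forall a b p, is_derive p (ebasis R b) (k1 a) (k2 a b p).
Hypothesis dk2 : forall a b c p, is_derive p (ebasis R c) (k2 a b) (k3 a b c p).
Hypothesis bk1 : forall a p, `|k1 a p| <= M.
Hypothesis bk2 : forall a b p, `|k2 a b p| <= M.
Hypothesis bk3 : forall a b c p, `|k3 a b c p| <= M.

(** One constant dominating [d^n M] for all [n <= 3], so that every estimate below shares it. *)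
Let Q := (1 + d%:R) ^+ 3 * M.

Let Q_ge (n : nat) : (n <= 3)%N -> d%:R ^+ n * M <= Q.
Proof.
move=> n3; rewrite /Q ler_wpM2r//.
rewrite (@le_trans _ _ ((1 + d%:R) ^+ n))//.
  by rewrite lerXn2r ?nnegrE// ?addr_ge0// lerDr.
by rewrite ler_weXn2l// lerDl.
Qed.

Lemma kernel_lipschitz x y : `|k x - k y| <= Q * `|x - y|.
Proof.
rewrite (le_trans (mean_value (M := M) dk _))// ler_wpM2r//.
by rewrite -[d%:R]expr1 Q_ge.
Qed.

Lemma kernel1_lipschitz a x y : `|k1 a x - k1 a y| <= Q * `|x - y|.
Proof.
rewrite (le_trans (mean_value (M := M) (dk1 a) _))// ler_wpM2r//.
by rewrite -[d%:R]expr1 Q_ge.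
Qed.

Lemma is_derive_translateB (f : 'cV[R]_d -> R) v (df : 'cV[R]_d -> R) y y' p :
  (forall p, is_derive p v f (df p)) ->
  is_derive p v (fun p => f (p - y) - f (p - y')) (df (p - y) - df (p - y')).
Proof.
by move=> H; apply: is_deriveB; apply: is_derive_translate.
Qed.

(** The mean value estimate in [x] is applied to [p |-> k (p - y) - k (p - y')], whose partial
    derivatives are of order [|y - y'|] by the same estimate one order higher. *)
Lemma kernel_mixed_lipschitz x x' y y' :
  `|(k (x - y) - k (x' - y)) - (k (x - y') - k (x' - y'))| <=
    Q * `|x - x'| * `|y - y'|.
Proof.
rewrite (_ : _ - _ = (k (x - y) - k (x - y')) - (k (x' - y) - k (x' - y'))); last by ring.
have := mean_value (x := x') (y := x) (M := d%:R * M * `|y - y'|)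
  (fun a p => is_derive_translateB y y' p (dk a)).
move=> /(_ _)/le_trans; apply.
  move=> a p _; rewrite (le_trans (mean_value (M := M) (dk1 a) _))//.
  by rewrite opprB [p - y + _]addrC subrKA distrC.
rewrite (_ : d%:R * _ * _ = d%:R ^+ 2 * M * `|x - x'| * `|y - y'|); last by ring.
by do 2 rewrite ler_wpM2r//; exact: Q_ge.
Qed.

Lemma kernel_taylor x x' :
  `|k x' - k x - \sum_a (x' - x) a ord0 * k1 a x| <= Q * `|x' - x| ^+ 2.
Proof.
rewrite (le_trans (taylor2 _ _ dk dk1 bk2))// ler_wpM2r ?sqr_ge0//.
by rewrite Q_ge.
Qed.

(** Taylor's estimate for [p |-> k (p - y) - k (p - y')]: its second derivatives are differences of
    [k2], and bounding them by [|y - y'|] is where the third derivative enters. *)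
Lemma kernel_taylor_lipschitz x x' y y' :
  `|(k (x' - y) - k (x - y) - \sum_a (x' - x) a ord0 * k1 a (x - y)) -
    (k (x' - y') - k (x - y') - \sum_a (x' - x) a ord0 * k1 a (x - y'))| <=
    Q * `|x' - x| ^+ 2 * `|y - y'|.
Proof.
have := taylor2 x x' (M := d%:R * M * `|y - y'|)
  (fun a p => is_derive_translateB y y' p (dk a))
  (fun a b p => is_derive_translateB y y' p (dk1 a b)).
have E : \sum_a (x' - x) a ord0 * (k1 a (x - y) - k1 a (x - y')) =
  \sum_a (x' - x) a ord0 * k1 a (x - y) - \sum_a (x' - x) a ord0 * k1 a (x - y').
  by rewrite -sumrB; apply: eq_bigr => a _; rewrite mulrBr.
rewrite E.
rewrite (_ : k (x' - y) - k (x' - y') - _ - _ =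
    (k (x' - y) - k (x - y) - \sum_a (x' - x) a ord0 * k1 a (x - y)) -
    (k (x' - y') - k (x - y') - \sum_a (x' - x) a ord0 * k1 a (x - y'))); last by ring.
move=> /(_ _)/le_trans; apply.
  move=> a b p; rewrite (le_trans (mean_value (M := M) (dk2 a b) _))//.
  by rewrite opprB [p - y + _]addrC subrKA distrC.
rewrite (_ : d%:R ^+ 2 * _ * _ = d%:R ^+ 3 * M * `|x' - x| ^+ 2 * `|y - y'|); last by ring.
by do 2 rewrite ler_wpM2r ?sqr_ge0//; exact: Q_ge.
Qed.

End KernelEstimates.

(** * Regularity of the field [K * xi] *)

Section ConvolutionField.
Variables (R : realType) (d : nat) (K : 'cV[R]_d -> 'M[R]_d).
Hypothesis KP : UCb3 K.

Lemma is_derive_entry (F : 'cV[R]_d -> 'M[R]_d) p v i j : derivable F p v ->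
  is_derive p v (fun q => F q i j) ('D_v F p i j).
Proof.
move=> dF; rewrite derive_mx// mxE; apply: derivableP.
by move/derivable_mxP : dF; exact.
Qed.

Let kernel_bound : exists2 M : R, 0 <= M & forall i j p,
  [/\ `|K p i j| <= M, forall a, `|pd K a p i j| <= M,
      forall a b, `|pd (pd K a) b p i j| <= M &
      forall a b c, `|pd (pd (pd K a) b) c p i j| <= M].
Proof.
have [_ _ [M HM] _] := KP; exists M.
  by have [+ _ _ _] := HM 0; apply: le_trans.
move=> i j p; have [H0 H1 H2 H3] := HM p.
by split => [|a|a b|a b c]; apply: le_trans (mx_norm_ge_entry _ i j) _.
Qed.

Let dK i j a p : is_derive p (ebasis R a) (fun q => K q i j) (pd K a p i j).
Proof. by have [[H _ _] _ _ _] := KP; exact: is_derive_entry. Qed.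

Let dK1 i j a b p :
  is_derive p (ebasis R b) (fun q => pd K a q i j) (pd (pd K a) b p i j).
Proof. by have [[_ H _] _ _ _] := KP; exact: is_derive_entry. Qed.

Let dK2 i j a b c p : is_derive p (ebasis R c) (fun q => pd (pd K a) b q i j)
  (pd (pd (pd K a) b) c p i j).
Proof. by have [[_ _ H] _ _ _] := KP; exact: is_derive_entry. Qed.

Definition row_test (F : 'cV[R]_d -> 'M[R]_d) x i (y : 'cV[R]_d) : 'cV[R]_d :=
  \col_j F (x - y) i j.

(** Partial derivative of the convolution with the differentiation moved onto the kernel; it serves
    as [A] in [C11_field]. *)
Definition Kconv_pd (xi : current R d) x a : 'cV[R]_d :=
  \col_i xi (row_test (pd K a) x i).

Lemma Cb_row_test x i : Cb (row_test K x i).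
Proof.
have [M M0 HM] := kernel_bound.
apply: (lipschitz_Cb (M := M) (m := (1 + d%:R) ^+ 3 * M)) => [y|y y'].
  by apply: mx_norm_le => // j ?; rewrite mxE; have [] := HM i j (x - y).
apply: mx_norm_le => [|j ?]; first by rewrite !mulr_ge0// exprn_ge0// addr_ge0.
rewrite !mxE; have := kernel_lipschitz M0 (dK i j)
  (fun a p => let: And4 _ H _ _ := HM i j p in H a) (x - y) (x - y').
by rewrite [- (x - y')]opprB [x - y + _]addrC subrKA [`|y' - y|]distrC.
Qed.

(** This lemma and the next two treat the test fields behind the three clauses of [C11_field]. Size
    and Lipschitz constant carry the same factor, as [BL_bounded] requires. *)
Lemma row_test1_bounds : exists2 Q : R, 0 <= Q & forall x i a,
  (forall y, `|row_test (pd K a) x i y| <= Q) /\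
  (forall y y', `|row_test (pd K a) x i y - row_test (pd K a) x i y'| <=
    Q * `|y - y'|).
Proof.
have [M M0 HM] := kernel_bound; pose Q := (1 + d%:R) ^+ 3 * M.
have Q0 : 0 <= Q by rewrite !mulr_ge0// exprn_ge0// addr_ge0.
exists Q => // x i a; split => [y|y y'].
  apply: mx_norm_le => // j ?; rewrite mxE.
  have [_ /(_ a) H _ _] := HM i j (x - y); rewrite (le_trans H)//.
  by rewrite ler_peMl// exprn_ege1// lerDl.
apply: mx_norm_le => [|j ?]; first by rewrite mulr_ge0.
rewrite !mxE; have := kernel1_lipschitz M0 (dK1 i j)
  (fun a b p => let: And4 _ _ H _ := HM i j p in H a b) a (x - y) (x - y').
by rewrite [- (x - y')]opprB [x - y + _]addrC subrKA [`|y' - y|]distrC.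
Qed.

Lemma row_test_bounds : exists2 Q : R, 0 <= Q & forall x x' i,
  let D y := row_test K x i y - row_test K x' i y in
  (forall y, `|D y| <= Q * `|x - x'|) /\
  (forall y y', `|D y - D y'| <= Q * `|x - x'| * `|y - y'|).
Proof.
have [M M0 HM] := kernel_bound; pose Q := (1 + d%:R) ^+ 3 * M.
have Q0 : 0 <= Q by rewrite !mulr_ge0// exprn_ge0// addr_ge0.
have b1 i j a p : `|pd K a p i j| <= M by have [] := HM i j p.
have b2 i j a b p : `|pd (pd K a) b p i j| <= M by have [] := HM i j p.
exists Q => // x x' i; split => [y|y y'].
  apply: mx_norm_le => [|j ?]; first by rewrite mulr_ge0.
  rewrite !mxE; have := kernel_lipschitz M0 (dK i j) (b1 i j) (x - y) (x' - y).
  by rewrite opprB subrKA.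
apply: mx_norm_le => [|j ?]; first by rewrite !mulr_ge0.
rewrite !mxE.
exact: (kernel_mixed_lipschitz M0 (dK i j) (dK1 i j) (b2 i j)).
Qed.

Lemma row_test_taylor_bounds : exists2 Q : R, 0 <= Q & forall x x' i,
  let D y := row_test K x' i y - row_test K x i y -
    \sum_a (x' - x) a ord0 *: row_test (pd K a) x i y in
  (forall y, `|D y| <= Q * `|x' - x| ^+ 2) /\
  (forall y y', `|D y - D y'| <= Q * `|x' - x| ^+ 2 * `|y - y'|).
Proof.
have [M M0 HM] := kernel_bound; pose Q := (1 + d%:R) ^+ 3 * M.
have Q0 : 0 <= Q by rewrite !mulr_ge0// exprn_ge0// addr_ge0.
have b2 i j a b p : `|pd (pd K a) b p i j| <= M by have [] := HM i j p.
have b3 i j a b c p : `|pd (pd (pd K a) b) c p i j| <= M by have [] := HM i j p.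
exists Q => // x x' i D.
have DE y j (l : 'I_1) : D y j l = K (x' - y) i j - K (x - y) i j -
    \sum_a (x' - x) a ord0 * pd K a (x - y) i j.
  rewrite /D mxE mxE [X in _ + X]mxE summxE !mxE; congr (_ - _).
  by apply: eq_bigr => a _; rewrite !mxE.
clearbody D; split => [y|y y'].
  apply: mx_norm_le => [|j ?]; first by rewrite mulr_ge0// sqr_ge0.
  have := kernel_taylor M0 (dK i j) (dK1 i j) (b2 i j) (x - y) (x' - y).
  by rewrite DE opprB subrKA.
apply: mx_norm_le => [|j l]; first by rewrite !mulr_ge0// sqr_ge0.
rewrite [(D y - D y') j l]mxE [(- D y') j l]mxE !DE.
exact: (kernel_taylor_lipschitz M0 (dK i j) (dK1 i j) (dK2 i j) (b3 i j)).
Qed.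

(** By linearity each quantity to be estimated is, componentwise, [xi t] of one of the test fields
    bounded above. [Q] comes from [K] alone, so the field constant depends on the currents only
    through [B]. *)
Lemma Kconv_C11 : exists2 Q : R, 0 <= Q & forall (T B : R) (xi : R -> current R d),
  0 <= B -> (forall t, 0 <= t <= T -> Cb_linear (xi t)) ->
  (forall t, 0 <= t <= T -> BL_bounded B (xi t)) ->
  C11_field T (B * Q) (fun t => Kconv K (xi t)) (fun t => Kconv_pd (xi t)).
Proof.
have [Q1 Q10 H1] := row_test1_bounds; have [Q2 Q20 H2] := row_test_bounds.
have [Q3 Q30 H3] := row_test_taylor_bounds.
exists (Q1 + Q2 + Q3); first by rewrite !addr_ge0.
move=> T B xi B0 lxi bxi t tT; have l := lxi t tT; have bd := bxi t tT.
have Cb1 x i a : Cb (row_test (pd K a) x i).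
  by have [h h'] := H1 x i a; exact: lipschitz_Cb h'.
have Q1le : Q1 <= Q1 + Q2 + Q3 by rewrite -addrA lerDl addr_ge0.
have Q2le : Q2 <= Q1 + Q2 + Q3 by rewrite addrAC lerDr addr_ge0.
have Q3le : Q3 <= Q1 + Q2 + Q3 by rewrite lerDr addr_ge0.
have Q0 : 0 <= Q1 + Q2 + Q3 by rewrite (le_trans Q10).
split => [x x'|x a|x x'].
- apply: mx_norm_le => [|i ?]; first by rewrite !mulr_ge0.
  rewrite !mxE -mulN1r -l; [|exact: Cb_row_test|exact: Cb_row_test].
  have [h h'] := H2 x x' i.
  rewrite (_ : (fun y => _) = (fun y => row_test K x i y - row_test K x' i y)).
    by rewrite (le_trans (bd _ _ h h'))// mulrA ler_wpM2r// ler_wpM2l.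
  by apply/funext => y; rewrite scaleN1r.
- apply: mx_norm_le => [|i ?]; first by rewrite mulr_ge0.
  rewrite mxE; have [h h'] := H1 x i a.
  by rewrite (le_trans (bd _ _ h h'))// ler_wpM2l.
- apply: mx_norm_le => [|i j]; first by rewrite !mulr_ge0// sqr_ge0.
  have [h h'] := H3 x x' i.
  (* Differences are written with the scalar [-1] to match the form in which linearity is stated. *)
  have C0 : Cb (fun y => row_test K x' i y + -1 *: row_test K x i y).
    by apply: CbDZ; exact: Cb_row_test.
  have [_ E] := Cb_linear_sum (index_enum 'I_d) (fun a => - (x' - x) a ord0) l C0
    (fun a => Cb1 x i a).
  have -> : (Kconv K (xi t) x' - Kconv K (xi t) x -
      \sum_a (x' - x) a ord0 *: Kconv_pd (xi t) x a) i j =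
      xi t (fun y => row_test K x' i y - row_test K x i y -
        \sum_a (x' - x) a ord0 *: row_test (pd K a) x i y).
    transitivity (xi t (fun y => row_test K x' i y + -1 *: row_test K x i y +
        \sum_a (- (x' - x) a ord0) *: row_test (pd K a) x i y)).
      rewrite E l; [|exact: Cb_row_test|exact: Cb_row_test].
      rewrite mxE mxE [X in _ + X = _]mxE summxE !mxE mulN1r -sumrN.
      congr (_ + _); apply: eq_bigr => a _; by rewrite !mxE mulNr.
    congr (xi t); apply/funext => y; rewrite scaleN1r -sumrN; congr (_ + _).
    by apply: eq_bigr => a _; rewrite scaleNr.
  by rewrite (le_trans (bd _ _ h h'))// mulrA ler_wpM2r ?sqr_ge0// ler_wpM2l.
Qed.

End ConvolutionField.

(** * Currents of families of curves *)

Section CurveCurrents.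
Variables (R : realType) (d : nat).
Implicit Types (theta : 'cV[R]_d -> 'cV[R]_d) (f g : R -> 'cV[R]_d).

Lemma edot_cvg (U : Type) (F : set_system U) (FF : Filter F)
    (f g : U -> 'cV[R]_d) (l l' : 'cV[R]_d) :
  f @ F --> l -> g @ F --> l' -> edot (f x) (g x) @[x --> F] --> edot l l'.
Proof.
move=> fl gl; apply: cvg_big => [|k _]; first exact: (@add_continuous R).
have cl := @coord_continuous R d 1 k ord0.
exact: (cvgM (cvg_comp _ _ fl (cl l)) (cvg_comp _ _ gl (cl l'))).
Qed.

Lemma edot_norm_le (u v : 'cV[R]_d) : `|edot u v| <= d%:R * (`|u| * `|v|).
Proof.
rewrite (le_trans (ler_norm_sum _ _ _))//.
rewrite (le_trans (ler_sum _ (G := fun=> `|u| * `|v|) _))//; last first.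
  by rewrite sumr_const card_ord -(mulr_natl (`|u| * _)).
by move=> k _; rewrite normrM ler_pM// mx_norm_ge_entry.
Qed.

Lemma edotDZl (u v w : 'cV[R]_d) (a : R) :
  edot (u + a *: v) w = edot u w + a * edot v w.
Proof.
rewrite /edot mulr_sumr -big_split /=; apply: eq_bigr => k _.
by rewrite !mxE mulrDl mulrA.
Qed.

Lemma itv01E : `[0%R, 1%R]%classic = [set s : R | 0 <= s <= 1].
Proof. by apply/seteqP; split => s /=; rewrite in_itv. Qed.

Lemma test_integrable theta g dg : Cb theta ->
  {within [set s : R | 0 <= s <= 1], continuous g} ->
  {within [set s : R | 0 <= s <= 1], continuous dg} ->
  (@lebesgue_measure R).-integrable `[0, 1]
    (EFin \o (fun s => edot (theta (g s)) (dg s))).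
Proof.
move=> [ct _] /subspace_continuousP cg /subspace_continuousP cdg.
apply: continuous_compact_integrable; first exact: segment_compact.
rewrite itv01E; apply/subspace_continuousP => s s01.
apply: edot_cvg; last exact: cdg.
exact: (cvg_comp _ _ (cg s s01) (ct _)).
Qed.

Lemma int01_bound (f : R -> R) (m : R) :
  (@lebesgue_measure R).-integrable `[0, 1] (EFin \o f) ->
  (forall s, 0 <= s <= 1 -> `|f s| <= m) -> `|int01 f| <= m.
Proof.
move=> If fm; have m01 : measurable (`[0%R, 1%R]%classic : set R) by [].
have Ic : (@lebesgue_measure R).-integrable `[0, 1] (EFin \o cst m).
  apply: continuous_compact_integrable; first exact: segment_compact.
  by apply: continuous_subspaceT => x; exact: cvg_cst.
rewrite (le_trans (le_normr_Rintegral _ If))//.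
apply: (@le_trans _ _ (\int[@lebesgue_measure R]_(_ in `[0%R, 1%R]) m)).
  by apply: le_Rintegral => //; exact: integrable_norm.
rewrite Rintegral_cst//.
rewrite (_ : fine _ = 1) ?mulr1//.
by have := @lebesgue_measure_itv R `[0, 1]; rewrite /= lte_fin ltr01 sube0 => ->.
Qed.

Section Family.
Variables (T : R) (N : nat) (alpha : 'I_N -> R).
Variable gamma : 'I_N -> R -> R -> 'cV[R]_d.

(** At [x = gamma i t s] the right-hand side is that of (E1); this is what turns (E1) into an
    ordinary differential equation for the field of the current. *)
Lemma Kconv_curves_current (K : 'cV[R]_d -> 'M[R]_d) t x :
  Kconv K (curves_current alpha gamma t) x =
  \sum_(j < N) alpha j *:
    vint01 (fun s => K (x - gamma j t s) *m deriv_on 0 1 (gamma j t) s).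
Proof.
apply/matrixP => i l; rewrite mxE summxE; apply: eq_bigr => j _.
rewrite mxE mxE; congr (_ * int01 _); apply/funext => s.
by rewrite mxE; apply: eq_bigr => k _; rewrite mxE.
Qed.

Hypothesis gammaC1 : forall j, C1_rect T (gamma j).

Lemma C1_rect_section j (t : R) : 0 <= t <= T ->
  {within [set s : R | 0 <= s <= 1], continuous (gamma j t)} /\
  {within [set s : R | 0 <= s <= 1], continuous (deriv_on 0 1 (gamma j t))}.
Proof.
move=> tT; have [_ /subspace_continuousP c1 _ /subspace_continuousP c2] := gammaC1 j.
(* The slice [r |-> (t, r)] maps [[0, 1]] into the rectangle, so joint continuity there restricts to
   it. *)
have sec (s : R) : 0 <= s <= 1 ->
    (((t : R), (r : R)) @[r --> within [set s : R | 0 <= s <= 1] (nbhs s)] -->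
      within (rect T) (nbhs ((t : R), s))).
  move=> s01 P /= [[A B] /= [At Bs] ABP]; rewrite /fmap /within /=.
  apply: filterS Bs => r Br r01; apply: (ABP (t, r)); last by split.
  by split => //=; exact: nbhs_singleton At.
split; apply/subspace_continuousP => s s01.
  exact: (cvg_comp _ _ (sec s s01) (c1 (t, s) _)).
exact: (cvg_comp _ _ (sec s s01) (c2 (t, s) _)).
Qed.

Lemma compact_rect : compact (rect T).
Proof.
rewrite (_ : rect T = `[0, T] `*` `[0, 1]).
  by apply: compact_setX; exact: segment_compact.
by apply/seteqP; split => -[t s] /=; rewrite !in_itv.
Qed.

Lemma C1_rect_deriv_bounded j : exists2 M : R, 0 <= M & forall t s,
  0 <= t <= T -> 0 <= s <= 1 -> `|deriv_on 0 1 (gamma j t) s| <= M.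
Proof.
have [_ _ _ c2] := gammaC1 j.
have /compact_bounded[M [_ HM]] := continuous_compact c2 compact_rect.
exists (`|M| + 1); first by rewrite addr_ge0.
move=> t s tT s01; apply: (HM (`|M| + 1)).
  by rewrite (le_lt_trans (ler_norm _))// ltrDl.
by exists (t, s).
Qed.

Lemma curves_current_linear t : 0 <= t <= T ->
  Cb_linear (curves_current alpha gamma t).
Proof.
move=> tT theta1 theta2 a C1 C2.
rewrite /curves_current mulr_sumr -big_split /=; apply: eq_bigr => j _.
rewrite mulrCA -mulrDr; congr (_ * _).
have [cg cdg] := C1_rect_section j tT.
have I1 := test_integrable C1 cg cdg; have I2 := test_integrable C2 cg cdg.
rewrite /int01 -RintegralZl// -RintegralD//; last first.
  exact: (integrableZl _ a I2).
by congr (Rintegral _ _); apply/funext => s; exact: edotDZl.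
Qed.

(** The [s]-derivatives are continuous on the compact rectangle, so one bound on the speed of each
    curve holds for all times. *)
Lemma curves_current_BL_bounded : exists2 B : R, 0 <= B & forall t, 0 <= t <= T ->
  BL_bounded B (curves_current alpha gamma t).
Proof.
have /choice[M HM] j : exists M : R, 0 <= M /\ forall t s,
    0 <= t <= T -> 0 <= s <= 1 -> `|deriv_on 0 1 (gamma j t) s| <= M.
  by have [M ? ?] := C1_rect_deriv_bounded j; exists M.
exists (\sum_j `|alpha j| * (d%:R * M j)).
  by apply: sumr_ge0 => j _; rewrite !mulr_ge0//; have [] := HM j.
move=> t tT theta m tm tl; rewrite /curves_current.
have Ct := lipschitz_Cb tm tl.
rewrite (le_trans (ler_norm_sum _ _ _))// mulr_suml; apply: ler_sum => j _.
rewrite normrM -mulrA ler_wpM2l//; have [cg cdg] := C1_rect_section j tT.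
apply: int01_bound (test_integrable Ct cg cdg) _ => s s01.
rewrite (le_trans (edot_norm_le _ _))// -mulrA ler_wpM2l// mulrC ler_pM//.
by have [_] := HM j; exact.
Qed.

End Family.

End CurveCurrents.

(** * Uniform bounds for weakly continuous families of currents *)

Section WeaklyContinuousCurrents.
Variables (R : realType) (d : nat).
Implicit Types (theta : 'cV[R]_d -> 'cV[R]_d) (xi : current R d).

Lemma is_current_linear xi : is_current xi -> Cb_linear xi.
Proof. by case. Qed.

Lemma Cb_0 : Cb (fun _ : 'cV[R]_d => 0 : 'cV[R]_d).
Proof.
apply: (lipschitz_Cb (M := 0) (m := 0)) => *; first by rewrite normr0.
by rewrite subrr normr0 mul0r.
Qed.

Lemma is_current0 xi : is_current xi -> xi (fun=> 0) = 0.
Proof.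
move=> [_ [D HD]]; apply/eqP; rewrite -normr_le0 -(mulr0 D).
apply: HD => [|x]; first exact: Cb_0.
by rewrite (le_trans (enorm_le_mx_norm _))// normr0 mulr0.
Qed.

Lemma is_current_BL1 xi : is_current xi ->
  exists2 C : R, 0 <= C & forall theta, BL1 theta -> `|xi theta| <= C.
Proof.
move=> [_ [C HC]]; exists `|C| => // theta [Ct [a [b [a0 b0 ab ta _]]]].
rewrite (le_trans (HC _ a Ct ta))// (le_trans (ler_norm _))// normrM.
by rewrite ler_piMr// ger0_norm//; move: a0 b0 ab; lra.
Qed.

Lemma BL1_opp theta : BL1 theta -> BL1 (fun x => 0 + -1 *: theta x).
Proof.
have enormN (v : 'cV[R]_d) : enorm (- v) = enorm v.
  by congr Num.sqrt; apply: eq_bigr => k _; rewrite !mxE mulrNN.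
move=> [Ct [a [b [a0 b0 ab ta tb]]]]; split.
  by apply: CbDZ => //; exact: Cb_0.
exists a, b; split => // [x|x y]; first by rewrite add0r scaleN1r enormN.
by rewrite !add0r !scaleN1r -opprD enormN.
Qed.

(** The supremum bounds each difference because both currents are bounded on [BL1]; the absolute
    value comes from the symmetry of [BL1]. *)
Lemma dM_lt xi xi' (e : R) : is_current xi -> is_current xi' ->
  dM xi xi' < e -> forall theta, BL1 theta -> `|xi theta - xi' theta| < e.
Proof.
move=> cxi cxi' dlt.
have [C C0 HC] := is_current_BL1 cxi; have [C' C'0 HC'] := is_current_BL1 cxi'.
have H theta : BL1 theta -> xi theta - xi' theta < e.
  move=> Bt; apply: le_lt_trans dlt; apply: ub_le_sup; last by exists theta.
  exists (C + C') => _ [psi Bp <-].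
  by rewrite (le_trans (ler_norm _))// (le_trans (ler_normB _ _))// lerD ?HC ?HC'.
move=> theta Bt; rewrite ltr_norml H// andbT.
have /H := BL1_opp Bt.
have Cb0 := Cb_0.
have [Ct _] := Bt.
rewrite (is_current_linear cxi)// (is_current_linear cxi')// !is_current0//.
lra.
Qed.

(** Rescaling: a nonzero field divided by a multiple of [m] lies in [BL1]. *)
Lemma BL1_bound_BL_bounded xi (C : R) : is_current xi ->
  (forall theta, BL1 theta -> `|xi theta| <= C) ->
  BL_bounded (C * (2 * (1 + d%:R))) xi.
Proof.
move=> cxi HC theta m tm tl.
have m0 : 0 <= m by apply: le_trans (tm 0).
have Ct := lipschitz_Cb tm tl.
have [mE|mN0] := eqVneq m 0.
  have [_ [D HD]] := cxi; rewrite mE mulr0 -(mulr0 D); apply: HD => // x.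
  rewrite (le_trans (enorm_le_mx_norm _))//.
  by rewrite (le_trans (ler_wpM2l _ (tm x)))// mE mulr0.
have mgt0 : 0 < m by rewrite lt_neqAle eq_sym mN0.
(* The factor 2 splits the unit budget of [BL1] between sup norm and Lipschitz constant; [1 + d]
   pays for passing from the max norm to the Euclidean one. *)
have Cb0 := Cb_0; pose q := 2 * (1 + d%:R) * m.
have q0 : 0 < q by rewrite !mulr_gt0// ltr_pwDl.
have qle (v : 'cV[R]_d) (r : R) : 0 <= r -> `|v| <= m * r ->
    enorm (q^-1 *: v) <= 1 / 2 * r.
  move=> r0 vr; rewrite (le_trans (enorm_le_mx_norm _))// normrZ gtr0_norm ?invr_gt0//.
  rewrite mulrCA ler_pdivrMl// (le_trans (ler_wpM2l _ vr))//.
  rewrite /q (_ : _ * (1 / 2 * r) = (1 + d%:R) * (m * r)); last by field.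
  by rewrite ler_wpM2r ?mulr_ge0// lerDr.
have Bt : BL1 (fun x => 0 + q^-1 *: theta x).
  split; first exact: CbDZ.
  exists (1 / 2), (1 / 2); split; try lra.
    by move=> x; rewrite add0r -[leRHS]mulr1 qle// mulr1.
  move=> x y; rewrite !add0r -scalerBr.
  rewrite (le_trans (qle _ `|x - y| _ _))// ler_wpM2l ?enorm_ge_mx_norm//; lra.
have := HC _ Bt; rewrite (is_current_linear cxi)// is_current0// add0r normrM.
rewrite gtr0_norm ?invr_gt0// ler_pdivrMl// mulrC => /le_trans; apply.
by rewrite -mulrA.
Qed.

(** Each time has a neighbourhood on which the bound on [BL1] grows by at most 1, the distance
    allowed in [dM]; compactness of [[0, T]] makes the bound uniform. *)
Lemma Mw_continuous_BL_bounded (T : R) (xi : R -> current R d) :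
  Mw_continuous T xi ->
  exists2 B : R, 0 <= B & forall t, 0 <= t <= T -> BL_bounded B (xi t).
Proof.
move=> [cxi xic].
have /compact_near_coveringP cov := @segment_compact R 0 T.
have : \forall C \near +oo%R, (`[0, T]%classic : set R) `<=`
    (fun s => 0 <= s <= T -> forall theta, BL1 theta -> `|xi s theta| <= C).
  apply: cov => t; rewrite /= in_itv /= => tT.
  have [C C0 HC] := is_current_BL1 (cxi t tT).
  have [r r0 Hr] := xic t tT 1 ltr01.
  exists ([set s | `|s - t| < r], [set D | C + 1 <= D]) => /=.
    split; last by apply: nbhs_pinfty_ge; exact: num_real.
    by apply/nbhs_ballP; exists r => //= s; rewrite -ball_normE /= distrC.
  move=> [s D] /= [st CD] sT theta Bt; apply: le_trans CD.
  have := dM_lt (cxi s sT) (cxi t tT) (Hr s sT st) Bt.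
  have := HC _ Bt.
  rewrite -{2}(subrK (xi t theta) (xi s theta)) => H1 /ltW H2.
  by rewrite (le_trans (ler_normD _ _))// addrC lerD.
move=> /filter_ex[C HC]; exists (`|C| * (2 * (1 + d%:R))).
  by rewrite !mulr_ge0// addr_ge0.
move=> t tT; apply: BL1_bound_BL_bounded => [|theta Bt]; first exact: cxi.
by apply: le_trans (ler_norm _); exact: HC.
Qed.

End WeaklyContinuousCurrents.

(** * Push-forward of the current of a family of curves *)

Section PushForwardOfCurves.
Variables (R : realType) (d : nat).
Implicit Types (theta : 'cV[R]_d -> 'cV[R]_d) (f g : R -> 'cV[R]_d).

Lemma has_deriv_on_ext (a b t : R) f g l : a <= t <= b ->
  (forall s, a <= s <= b -> f s = g s) ->
  has_deriv_on a b f t l -> has_deriv_on a b g t l.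
Proof.
move=> tab fg /has_deriv_onP H; apply/has_deriv_onP => e /H[r r0 Hr].
by exists r => // s sab st; rewrite -!fg//; exact: Hr.
Qed.

(** The test field inside [push], so that [push phi xi theta] unfolds to
    [xi (push_test phi theta)]. *)
Definition push_test (phi : 'cV[R]_d -> 'cV[R]_d) theta (x : 'cV[R]_d) : 'cV[R]_d :=
  \col_j edot (theta (phi x)) ('D_(ebasis R j) phi x).

(** Transposition: the adjoint of the derivative of [phi] on [theta] becomes the derivative itself
    on the tangent vector [l]. *)
Lemma edot_push_test phi theta x (l : 'cV[R]_d) :
  edot (push_test phi theta x) l =
  edot (theta (phi x)) (\sum_a l a ord0 *: 'D_(ebasis R a) phi x).
Proof.
rewrite /edot; under eq_bigr do rewrite mxE mulr_suml.
rewrite exchange_big /=; apply: eq_bigr => k _.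
rewrite summxE mulr_sumr; apply: eq_bigr => a _.
by rewrite !mxE; ring.
Qed.

Lemma cvg_col (U : topologicalType) (f : U -> 'cV[R]_d) (x : U) :
  (forall k, (f y k ord0) @[y --> x] --> f x k ord0) -> f @ x --> f x.
Proof.
move=> H; apply/cvgrPdist_le => e e0.
have : \forall y \near x, forall k, `|f x k ord0 - f y k ord0| <= e.
  by apply: filter_forall => k; have /cvgrPdist_le := H k; exact.
apply: filterS => y Hy; apply: mx_norm_le => [|k j]; first exact: ltW.
by rewrite (ord1 j) !mxE.
Qed.

Section Flow.
Variables (T L : R) (b : R -> 'cV[R]_d -> 'cV[R]_d).
Variables (A : R -> 'cV[R]_d -> 'I_d -> 'cV[R]_d).
Hypotheses (L0 : 0 <= L) (bA : C11_field T L b A).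
Variable phi : R -> 'cV[R]_d -> 'cV[R]_d.
Hypothesis phiP : is_flow T b phi.

(** Equality of currents is tested on [Cb] only, so the pulled-back field must lie there; its
    continuity rests on the Lipschitz dependence of the derivative of the flow. *)
Lemma Cb_push_test theta t : 0 <= t <= T -> Cb theta -> Cb (push_test (phi t) theta).
Proof.
move=> tT /CbP[ct [M HM]]; apply/CbP.
have [C1 _ H1] := flow_lipschitz L0 bA phiP.
have [C2 _ H2] := flow_derive_lipschitz L0 bA phiP.
have [C3 C30 H3] := flow_derive_bounded L0 bA phiP.
have cphi := lipschitz_continuous (fun x y => H1 t x y tT).
have M0 : 0 <= M by apply: le_trans (HM 0).
split.
  move=> x; apply: cvg_col => k.
  have cD := lipschitz_continuous (fun x y => H2 t y x k tT).
  rewrite [X in _ --> X]mxE; under eq_fun do rewrite mxE.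
  apply: edot_cvg; [exact: nbhs_filter | | exact: cD].
  exact: (@continuous_comp _ _ _ (phi t) theta x (cphi x) (ct _)).
exists (d%:R * (M * C3)) => x; apply: mx_norm_le => [|k j].
  by rewrite !mulr_ge0.
rewrite mxE (le_trans (edot_norm_le _ _))// ler_wpM2l// ler_pM//.
exact: H3.
Qed.

Lemma deriv_on_flow_curve g t s : 0 <= t <= T -> 0 <= s <= 1 ->
  derivable_on 0 1 g s ->
  has_deriv_on 0 1 (fun r => phi t (g r)) s
    (\sum_a (deriv_on 0 1 g s) a ord0 *: 'D_(ebasis R a) (phi t) (g s)).
Proof. by move=> tT s01 dg; exact: (flow_chain_rule L0 bA phiP tT). Qed.

(** The integrands agree pointwise by transposition and the chain rule. [h] need match [phi t] along
    [g] on [[0, 1]] only, since [deriv_on 0 1] sees no other values. *)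
Lemma int01_push_test theta g h t : 0 <= t <= T ->
  (forall s, 0 <= s <= 1 -> derivable_on 0 1 g s) ->
  (forall s, 0 <= s <= 1 -> h s = phi t (g s)) ->
  int01 (fun s => edot (push_test (phi t) theta (g s)) (deriv_on 0 1 g s)) =
  int01 (fun s => edot (theta (h s)) (deriv_on 0 1 h s)).
Proof.
move=> tT dg hE; apply: eq_Rintegral => s.
rewrite inE /= in_itv /= => s01; rewrite edot_push_test -hE//; congr edot.
apply/esym/has_deriv_on_unique => //.
apply: has_deriv_on_ext (deriv_on_flow_curve tT s01 (dg s s01)) => //.
by move=> r r01; rewrite hE.
Qed.

End Flow.
End PushForwardOfCurves.

(** * Passage between the curve system and the flow equation *)

Theorem theorem6p1 (R : realType) (d N : nat) (K : 'cV[R]_d -> 'M[R]_d)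
    (alpha : 'I_N -> R) (T : R) :
  0 < T -> UCb3 K ->
  (forall gamma : 'I_N -> R -> R -> 'cV[R]_d,
      (forall i, C1_rect T (gamma i)) ->
      solves_E1 T alpha K gamma ->
      flow_eq T K (curves_current alpha gamma))
  /\
  (forall (gamma0 : 'I_N -> R -> 'cV[R]_d) (xi : R -> current R d),
      (forall i, C1_01 (gamma0 i)) ->
      Mw_continuous T xi ->
      flow_eq T K xi ->
      eqM (xi 0) (curves_current alpha (fun j _ s => gamma0 j s) 0) ->
      (forall xi' : R -> current R d, Mw_continuous T xi' -> flow_eq T K xi' ->
          eqM (xi' 0) (xi 0) -> forall t, 0 <= t <= T -> eqM (xi' t) (xi t)) ->
      forall phi, is_flow T (fun t => Kconv K (xi t)) phi ->
        (forall t, 0 <= t <= T ->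
           eqM (xi t) (curves_current alpha (fun i t s => phi t (gamma0 i s)) t)) /\
        solves_E1 T alpha K (fun i t s => phi t (gamma0 i s))).
Proof.
move=> T0 KP; have [Q Q0 HQ] := Kconv_C11 KP.
have zT : 0 <= (0 : R) <= T by rewrite lexx ltW.
split.
  move=> gamma gC1 E1 phi phiP t tT theta Ct.
  have [B B0 HB] := curves_current_BL_bounded alpha gC1.
  have bA := HQ T B _ B0 (fun t => curves_current_linear alpha gC1 (t := t)) HB.
  have BQ0 : 0 <= B * Q by rewrite mulr_ge0.
  (* By (E1), for fixed [s] the curve in time is a trajectory of the field of its own current, hence
     a flow line. *)
  have gE j r s : 0 <= r <= T -> 0 <= s <= 1 ->
      gamma j r s = phi r (gamma j 0 s).
    move=> rT s01.
    apply: (flow_unique BQ0 bA phiP (g := fun r => gamma j r s)) => // q qT.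
    have [dt _ E] := E1 j q s qT s01.
    by rewrite Kconv_curves_current -E.
  rewrite -[RHS]/(curves_current alpha gamma 0 (push_test (phi t) theta)).
  rewrite /curves_current; apply: eq_bigr => j _.
  rewrite (int01_push_test BQ0 bA phiP theta (h := gamma j t))// => s s01.
    by have [H _ _ _] := gC1 j; have [] := H 0 s zT s01.
  exact: gE.
move=> gamma0 xi gC1 xiC xiF xi0 _ phi phiP.
have [cxi _] := xiC.
have [B B0 HB] := Mw_continuous_BL_bounded xiC.
have bA := HQ T B _ B0 (fun t tT => is_current_linear (cxi t tT)) HB.
have BQ0 : 0 <= B * Q by rewrite mulr_ge0.
have dg j s : 0 <= s <= 1 -> derivable_on 0 1 (gamma0 j) s.
  by have [+ _ _] := gC1 j; exact.
have E2 t : 0 <= t <= T ->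
    eqM (xi t) (curves_current alpha (fun i t s => phi t (gamma0 i s)) t).
  move=> tT theta Ct; rewrite (xiF phi phiP t tT theta Ct).
  (* The initial current may be replaced by that of the initial curves, the pulled-back field being
     an admissible test. *)
  rewrite -[LHS]/(xi 0 (push_test (phi t) theta)) xi0; last exact: (Cb_push_test BQ0 bA phiP).
  rewrite /curves_current; apply: eq_bigr => j _.
  rewrite (int01_push_test BQ0 bA phiP theta (h := fun s => phi t (gamma0 j s)))//.
  by move=> s s01; exact: dg.
split => // i t s tT s01.
have [_ Hphi] := phiP (gamma0 i s).
split.
- exact: has_deriv_on_derivable (Hphi t tT).
- exact: has_deriv_on_derivable (deriv_on_flow_curve BQ0 bA phiP tT s01 (dg i s s01)).
rewrite (has_deriv_on_unique T0 tT (Hphi t tT)).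
rewrite -(Kconv_curves_current alpha (fun i t s => phi t (gamma0 i s))).
(* Both fields are the currents evaluated on rows of [K], which lie in [Cb]; the representation just
   proved makes them equal. *)
by apply/matrixP => k l; rewrite !mxE E2//; exact: (Cb_row_test KP).
Qed.
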